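(* For $n\ge1$ let $\mu_n=\frac Tn\sum_{i=0}^{n-1}\delta_{iT/n}$ and \[ f_n(t,x)=\mathbb{E}\Big[\exp\Big(\int_t^T\sum_{i=1}^3u_i(s)p_i(X_s)\mu_n(ds)+v(T)q(X_T)\Big)\,\Big|\,X_t=x\Big]. \] Then for each fixed $t\in[0,T]$, $f_n(t,\cdot)$ is entire on $\mathbb{R}$ (equal to a power series in $x$ with infinite radius of convergence).
   Context: Let $W$ be a Brownian motion; $a,b\in\mathbb{R}$, $c\ne0$, $T>0$; $dX_t=(a+bX_t)dt+c\,dW_t$. Negligible to double factorial: $\limsup_k(|p_k|(k-1)!!)^{1/k}=0$, $(-1)!!=0!!=1$. Standing assumptions: $u_1,u_2,u_3,v:[0,T]\to\mathbb{C}$ continuous with $\Re(u_1)\le0$, $\Re(u_2)=\Re(u_3)=\Re(v)=0$; $p_1=p^2$ for a real-coefficient power series $p$ negligible to double factorial; $p_2,p_3,q$ real-coefficient power series negligible to double factorial. *)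

(* Defs.v *)
From HB Require Import structures.
From mathcomp Require Import all_boot all_order all_algebra.
From mathcomp Require Import all_classical all_reals all_analysis.
From mathcomp Require Import complex.

Set Implicit Arguments.
Unset Strict Implicit.
Unset Printing Implicit Defensive.

Import Order.TTheory GRing.Theory Num.Theory.
Import numFieldNormedType.Exports.

Local Open Scope classical_set_scope.
Local Open Scope ring_scope.

Section defs.
Context {R : realType}.

Fixpoint dfact (k : nat) : nat :=
  match k with
  | 0%N => 1%N
  | 1%N => 1%N
  | k'.+2 => (k'.+2 * dfact k')%N
  end.

Definition dfact_pred (k : nat) : nat := if k is k'.+1 then dfact k' else 1%N.

(* A real-coefficient power series p = sum_k p_k x^k (coefficients p : nat -> R)
   is negligible to double factorial:
   limsup_k (|p_k| (k-1)!!)^(1/k) = 0.  Since the terms are >= 0, this is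
   "for every eps > 0, eventually (|p_k| (k-1)!!)^(1/k) <= eps". *)
Definition negligible_dfact (p : nat -> R) : Prop :=
  forall eps : R, 0 < eps ->
    \forall k \near \oo,
      ((`|p k| * (dfact_pred k)%:R) `^ (k%:R)^-1 <= eps).

Definition pow_series (p : nat -> R) (x : R) : R :=
  limn (series (fun k => p k * x ^+ k)).

Definition pseries_sq (p : nat -> R) : nat -> R :=
  fun k => \sum_(i < k.+1) p i * p (k - i)%N.

Definition Re_c (z : R[i]) : R := let: (x +i* _)%C := z in x.
Definition Im_c (z : R[i]) : R := let: (_ +i* y)%C := z in y.

(* continuity of a complex-valued function on A (componentwise; R[i] carries
   no topology instance here, and continuity in C = R^2 is componentwise) *)
Definition ccontinuous_on (A : set R) (u : R -> R[i]) : Prop :=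
  {within A, continuous (fun s => Re_c (u s))} /\
  {within A, continuous (fun s => Im_c (u s))}.

Definition ccvg (z : nat -> R[i]) (l : R[i]) : Prop :=
  ((fun N => Re_c (z N)) @ \oo --> Re_c l) /\ ((fun N => Im_c (z N)) @ \oo --> Im_c l).

Definition RtoC (x : R) : R[i] := (x +i* 0)%C.

Definition cexp (z : R[i]) : R[i] :=
  ((expR (Re_c z))%:C * (cos (Im_c z) +i* sin (Im_c z)))%C.

Definition cexpectation d (Om : measurableType d) (P : probability Om R)
  (Z : Om -> R[i]) : R[i] :=
  ((Rintegral P setT (fun w => Re_c (Z w)))
     +i* (Rintegral P setT (fun w => Im_c (Z w))))%C.

Definition brownian_motion d (Om : measurableType d) (P : probability Om R)
  (W : R -> Om -> R) : Prop :=
  [/\ (forall s, 0 <= s -> measurable_fun setT (W s)),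
      (forall w, W 0 w = 0),
      (forall w, {within [set s | 0 <= s], continuous (fun s => W s w)}),
      (forall s t, 0 <= s -> s < t -> forall B : set R, measurable B ->
         P ((fun w => W t w - W s w) @^-1` B)
         = normal_prob 0 (Num.sqrt (t - s)) B) &
      (forall (k : nat) (tt : nat -> R) (B : nat -> set R),
         0 <= tt 0%N ->
         (forall i, (i < k)%N -> tt i < tt i.+1) ->
         (forall i, measurable (B i)) ->
         P (\bigcap_(i in [set i | (i < k)%N])
              ((fun w => W (tt i.+1) w - W (tt i) w) @^-1` B i))
         = \big[*%E/1%E]_(i < k) P ((fun w => W (tt i.+1) w - W (tt i) w) @^-1` B i))].

(* Y = Y^{t,x} is the (pathwise, continuous) solution on [t,T] of
   dY_s = (a + b Y_s) ds + c dW_s with Y_t = x, i.e.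
   Y_s = x + int_t^s (a + b Y_r) dr + c (W_s - W_t). *)
Definition ou_solution_from d (Om : measurableType d) (W : R -> Om -> R)
  (a b c T t x : R) (Y : R -> Om -> R) : Prop :=
  forall w,
    {within `[t, T], continuous (fun s => Y s w)} /\
    forall s, t <= s <= T ->
      Y s w = x + Rintegral lebesgue_measure `[t, s] (fun r => a + b * Y r w)
                + c * (W s w - W t w).

Definition mu_n_integral (n : nat) (T t : R) (g : R -> R[i]) : R[i] :=
  (T / n%:R)%:C%C * \sum_(i < n | t <= i%:R * T / n%:R <= T) g (i%:R * T / n%:R).

End defs.

(* Main.v *)
Require Import Defs.
From HB Require Import structures.
From mathcomp Require Import all_boot all_order all_algebra.
From mathcomp Require Import all_classical all_reals all_analysis.
From mathcomp Require Import complex.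
From mathcomp Require Import measurable_realfun ring lra.
Import Order.TTheory GRing.Theory Num.Theory.
Import numFieldNormedType.Exports.
Local Open Scope classical_set_scope.
Local Open Scope ring_scope.

(** Let s be the first grid point strictly after t. Adding kappa (r - t), stopped
    at r = s, to the path of W moves X_s and all later values exactly as replacing
    the starting point 0 by x does, when kappa = lambda x for a suitable lambda.
    By Cameron-Martin the density of that shift only involves the single Gaussian
    variable Delta = W_s - W_t, so that
      E[H(X^x)] = exp(- kappa^2 (s - t) / 2) E[H(X^0) exp(kappa Delta)]
    for every bounded continuous functional H of the values of X on the grid after
    t. The right-hand side is entire in x because Delta has all exponential
    moments; a grid point at t itself only contributes a deterministic entire
    factor.

    The shift formula is proved for the Euler scheme, where only finitely many
    independent increments of W matter, and passes to the limit since the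
    scheme converges along every continuous path. *)

(** * Entire functions of a real variable *)

Section real_entire.
Context {R : realType}.
Implicit Types (a b c : nat -> R) (g h : R -> R).

(** The shift keeps the functional at the fixed starting point 0, where it is bounded by 1, and
    leaves x only in the Gaussian weight. With tau = s - t, starting from x instead of 0 changes X_s
    by x e^{b tau}, while the slope kappa on W changes it by c kappa (e^{b tau} - 1) / b. Equating
    the two gives lambda = b e^{b tau} / (c (e^{b tau} - 1)), or 1 / (c tau) when b = 0; this is
    where c <> 0 enters. The Euler scheme has its own rate [shift_rate], for which the two effects
    cancel exactly on each sufficiently fine mesh and not only in the limit; these rates converge to
    lambda. *)

Lemma cvgn_sum (I : Type) (r : seq I) (P : pred I) (F : I -> nat -> R) (l : I -> R) :
  (forall i, P i -> F i @ \oo --> l i) ->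
  (fun N => \sum_(i <- r | P i) F i N) @ \oo --> \sum_(i <- r | P i) l i.
Proof. by move=> Fl; apply: cvg_big => //; exact: add_continuous. Qed.

(** Dominated convergence for series. Beyond a fixed M, the tails of [series l] and of every
    [series (d ^~ N)] are at most the tail of [series m], and the first M terms form a finite sum of
    limits. *)
Lemma tannery (d : nat -> nat -> R) (l m s : nat -> R) (S : R) :
  (forall n, d n @ \oo --> l n) -> (forall n N, `|d n N| <= m n) ->
  cvgn (series m) -> (forall N, series (d ^~ N) @ \oo --> s N) ->
  series l @ \oo --> S -> s @ \oo --> S.
Proof.
move=> dl dm cm ds lS.
have m0 n : 0 <= m n by rewrite (le_trans _ (dm n 0%N)).
have lm n : `|l n| <= m n.
  have h : (fun N => `|d n N|) @ \oo --> `|l n| by apply: cvg_norm; exact: dl.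
  rewrite -(cvg_lim _ h)//.
  by apply: limr_le; [apply/cvg_ex; eexists; exact: h | apply: nearW].
have tail (u : nat -> R) (U : R) M : (forall n, `|u n| <= m n) ->
    series u @ \oo --> U -> `|U - series u M| <= limn (series m) - series m M.
  move=> um uU.
  have : `|series u N - series u M| @[N --> \oo] --> `|U - series u M|.
    by apply: cvg_norm; apply: cvgB => //; exact: cvg_cst.
  move=> h; rewrite -(cvg_lim _ h)//; apply: limr_le; first by apply/cvg_ex; eexists; exact: h.
  near=> N; have MN : (M <= N)%N by near: N; exact: nbhs_infty_ge.
  rewrite sub_series_geq//; apply: (le_trans (ler_norm_sum _ _ _)).
  apply: (@le_trans _ _ (series m N - series m M)).
    by rewrite sub_series_geq//; apply: ler_sum.
  by rewrite lerD2r; apply: nondecreasing_cvgn_le => //; exact: nondecreasing_series.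
apply/cvgrPdist_lt => e e0.
have [M hM] : exists M, limn (series m) - series m M < e / 3.
  move/cvgrPdist_lt : cm => /(_ (e/3)) [|M _ /(_ M (leqnn M))/= h]; first by rewrite divr_gt0.
  by exists M; exact: le_lt_trans (ler_norm _) h.
have : (fun N => series (d ^~ N) M) @ \oo --> series l M by apply: cvgn_sum => i _.
move/cvgrPdist_lt => /(_ (e/3)) [|N0 _ hN]; first by rewrite divr_gt0.
exists N0 => // N /hN /= {}hN.
have := tail l S M lm lS; have := tail (d ^~ N) (s N) M (dm ^~ N) (ds N).
move: hN hM; rewrite !ltr_norml !ler_norml.
set x := series _ M; set y := series _ M; set z := series m M; set w := limn _.
lra.
Unshelve. all: by end_near. Qed.

(** Tannery's theorem applied to rows truncated at K: the n-th term [series (c n) K] tends to [s n]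
    under the bound [m n], and summing it over n gives the finite sum of the first K column sums. *)
Lemma double_series_swap (c : nat -> nat -> R) (m s b : nat -> R) (S : R) :
  (forall n K, series (fun k => `|c n k|) K <= m n) -> cvgn (series m) ->
  (forall n, series (c n) @ \oo --> s n) ->
  (forall k, series (c ^~ k) @ \oo --> b k) ->
  series s @ \oo --> S -> series b @ \oo --> S.
Proof.
move=> cm mc cs cb sS.
apply: (@tannery (fun n K => series (c n) K) s m (series b) S) => //.
  by move=> n K; apply: le_trans (ler_norm_sum _ _ _) (cm n K).
move=> N; rewrite (_ : series _ = (fun M => \sum_(0 <= k < N) series (c ^~ k) M)); last first.
  by apply/funext => M; rewrite /series/= exchange_big.
exact: cvgn_sum.
Qed.

(** Convergence at every real point is an infinite radius of convergence; absolute convergence at r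
    follows from convergence at the larger radius |r| + 1. *)
Definition power_sum a g := forall x, series (fun k => a k * x ^+ k) @ \oo --> g x.

Definition entire g := exists a, power_sum a g.

Lemma power_sum_abs {a g} : power_sum a g ->
  forall r, cvgn (series (fun k => `|a k| * r ^+ k)).
Proof.
move=> ag r; apply: (@is_cvg_pseries_inside_norm _ a (`|r| + 1) r).
  by apply/cvg_ex; eexists; exact: ag.
by rewrite [ltRHS]ger0_norm ?addr_ge0// ltrDl.
Qed.

Definition abs_sum a r := limn (series (fun k => `|a k| * r ^+ k)).

Lemma abs_sum_ge {a g} : power_sum a g -> forall r, 0 <= r ->
  forall K, series (fun k => `|a k| * r ^+ k) K <= abs_sum a r.
Proof.
move=> ag r r0 K; apply: nondecreasing_cvgn_le; last exact: power_sum_abs ag r.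
by apply: nondecreasing_series => k _ _; rewrite mulr_ge0// exprn_ge0.
Qed.

Lemma abs_sum_ge0 {a g} : power_sum a g -> forall r, 0 <= r -> 0 <= abs_sum a r.
Proof. by move=> ag r r0; have := abs_sum_ge ag r r0 0%N; rewrite /series/= big_nil. Qed.

(** Truncated subtraction makes the right-hand side the empty sum when K < n. *)
Lemma series_shift (u : nat -> R) (n K : nat) :
  series (fun k => if (n <= k)%N then u (k - n)%N else 0) K = series u (K - n)%N.
Proof.
rewrite /series/= big_mkord -big_mkcond/= -(big_geq_mkord n K xpredT (fun k => u (k - n)%N)).
by rewrite -{1}[n]add0n big_addn; apply: eq_bigr => i _; rewrite addnK.
Qed.

End real_entire.

(** * Products, compositions and standard examples of entire functions *)

Section entire_closure.
Context {R : realType}.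
Implicit Types (a b c : nat -> R) (g h : R -> R).

Definition cauchy_prod a b : nat -> R := fun k => \sum_(i < k.+1) a i * b (k - i)%N.

Lemma power_sumM {a b g h} : power_sum a g -> power_sum b h ->
  power_sum (cauchy_prod a b) (fun x => g x * h x).
Proof.
move=> ag bh x.
(* The column index k is the total degree: row n is the series of [b] delayed by n and multiplied by
   the n-th term of [a], and column k sums to the k-th Cauchy coefficient. *)
pose c n k := if (n <= k)%N then a n * x ^+ n * (b (k - n)%N * x ^+ (k - n)) else 0.
apply: (@double_series_swap _ c (fun n => `|a n| * `|x| ^+ n * abs_sum b `|x|)
   (fun n => a n * x ^+ n * h x)).
- move=> n K; pose u k := `|a n| * `|x| ^+ n * (`|b k| * `|x| ^+ k).
  rewrite (_ : (fun k => _) = (fun k => if (n <= k)%N then u (k - n)%N else 0)).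
    rewrite series_shift /u /series/= -mulr_sumr.
    by apply: ler_wpM2l; [rewrite mulr_ge0// exprn_ge0 | apply: (abs_sum_ge bh)].
  by apply/funext => k; rewrite /c /u; case: ifP => _; rewrite ?normr0// !normrM !normrX.
- rewrite (_ : series _ = (fun N => series (fun k => `|a k| * `|x| ^+ k) N * abs_sum b `|x|)).
    by apply: is_cvgMl; exact: (power_sum_abs ag).
  by apply/funext => N; rewrite /series/= mulr_suml.
- move=> n; rewrite (_ : series _ = (fun K => a n * x ^+ n * series (fun k => b k * x ^+ k) (K - n)%N)).
    by apply: cvgMl_tmp; rewrite -(cvg_shiftn n); under eq_fun do rewrite addnK; exact: bh.
  apply/funext => K; rewrite (series_shift (fun j => a n * x ^+ n * (b j * x ^+ j))).
  by rewrite /series/= mulr_sumr.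
- move=> k; apply: cvg_near_cst; exists k.+1 => // N /= kN.
  rewrite /series/= (big_cat_nat (n := k.+1))//= [X in _ + X]big_nat_cond [X in _ + X]big1 ?addr0; last first.
    by move=> i /andP[/andP[ki _] _]; rewrite /c leqNgt ki.
  rewrite big_mkord /cauchy_prod mulr_suml; apply: eq_bigr => i _.
  by rewrite /c -ltnS ltn_ord mulrACA -exprD subnKC// -ltnS.
- rewrite (_ : series _ = (fun N => series (fun k => a k * x ^+ k) N * h x)).
    by apply: cvgMr_tmp; exact: ag.
  by apply/funext => N; rewrite /series/= mulr_suml.
Qed.

(** Submultiplicativity of the weighted norm sum |a_k| r^k. Arbitrary bounds A and B let an
    induction carry the bound ([abs_sum a r])^n for the n-th power. *)
Lemma cauchy_prod_abs_le a b (A B r : R) : 0 <= r ->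
  (forall K, series (fun k => `|a k| * r ^+ k) K <= A) ->
  (forall K, series (fun k => `|b k| * r ^+ k) K <= B) ->
  forall K, series (fun k => `|cauchy_prod a b k| * r ^+ k) K <= A * B.
Proof.
move=> r0 hA hB K.
have A0 : 0 <= A by have := hA 0%N; rewrite /series/= big_nil.
have B0 : 0 <= B by have := hB 0%N; rewrite /series/= big_nil.
pose u n k := if (n <= k)%N then `|a n| * r ^+ n * (`|b (k - n)%N| * r ^+ (k - n)) else 0.
have u0 n k : 0 <= u n k by rewrite /u; case: ifP => // _; rewrite !mulr_ge0 ?exprn_ge0.
apply: (@le_trans _ _ (\sum_(0 <= k < K) \sum_(0 <= n < K) u n k)).
  apply: ler_sum_nat => k /andP[_ kK].
  rewrite (big_cat_nat (n := k.+1))//= -[leLHS]addr0; apply: lerD; last exact: sumr_ge0.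
  rewrite big_mkord -[r in leLHS]ger0_norm// -normrX -normrM /cauchy_prod mulr_suml.
  apply: le_trans (ler_norm_sum _ _ _) _; apply: ler_sum => i _.
  by rewrite /u -ltnS ltn_ord mulrACA -exprD subnKC -1?ltnS// !normrM normrX (ger0_norm r0).
rewrite exchange_big/=.
apply: (@le_trans _ _ (\sum_(0 <= n < K) `|a n| * r ^+ n * B)).
  apply: ler_sum => n _.
  rewrite -[leLHS]/(series (fun k => if (n <= k)%N then
    (fun j => `|a n| * r ^+ n * (`|b j| * r ^+ j)) (k - n)%N else 0) K) series_shift.
  rewrite /series/= -mulr_sumr; apply: ler_wpM2l; last exact: hB.
  by rewrite mulr_ge0// exprn_ge0.
by rewrite -mulr_suml; apply: ler_wpM2r => //; exact: hA.
Qed.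

Lemma power_sum_cst (z : R) : power_sum (fun k => if k is 0%N then z else 0) (fun=> z).
Proof.
move=> x; apply: cvg_near_cst; exists 1%N => // N /= N1.
rewrite /series/= (big_cat_nat (n := 1%N))//= big_nat1 expr0 mulr1 big_nat_cond big1 ?addr0//.
by move=> [|i]; rewrite ?mul0r// ltnn.
Qed.

(** In sum_n b_n h(x)^n each power of h is expanded and the two sums are exchanged. The weighted
    norm of h^n is at most ([abs_sum a |x|])^n, so the double series is dominated by sum_n |b_n|
    ([abs_sum a |x|])^n, which converges because g has infinite radius. *)
Lemma entire_comp g h : entire g -> entire h -> entire (fun x => g (h x)).
Proof.
move=> [b bg] [a ah].
have [pw hpw] : {pw : nat -> nat -> R & forall n,
    power_sum (pw n) (fun x => h x ^+ n) /\
    forall r K, 0 <= r -> series (fun k => `|pw n k| * r ^+ k) K <= abs_sum a r ^+ n}.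
  apply: (@choice _ _ (fun n p => power_sum p (fun x => h x ^+ n) /\
    forall r K, 0 <= r -> series (fun k => `|p k| * r ^+ k) K <= abs_sum a r ^+ n)).
  elim=> [|n [p [hp hp']]].
    exists (fun k => if k is 0%N then 1 else 0); split; first exact: power_sum_cst.
    move=> r [|K] r0; first by rewrite /series/= big_nil.
    rewrite /series/= (big_cat_nat (n := 1%N))//= big_nat1 !expr0 normr1 mul1r.
    rewrite big_nat_cond big1 ?addr0//.
    by move=> [|i]; rewrite ?normr0 ?mul0r// ltnn.
  exists (cauchy_prod a p); split.
    by under [X in power_sum _ X]funext do rewrite exprS; exact: power_sumM.
  move=> r K r0; rewrite exprS; apply: cauchy_prod_abs_le => //.
    by move=> ?; apply: (abs_sum_ge ah).
  by move=> ?; apply: hp'.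
exists (fun k => limn (series (fun n => b n * pw n k))) => x.
have mc : cvgn (series (fun n => `|b n| * abs_sum a `|x| ^+ n)) by exact: (power_sum_abs bg).
apply: (@double_series_swap _ (fun n k => b n * pw n k * x ^+ k)
  (fun n => `|b n| * abs_sum a `|x| ^+ n) (fun n => b n * h x ^+ n)) => //.
- move=> n K; have := (hpw n).2 `|x| K (normr_ge0 x) => /(ler_wpM2l (normr_ge0 (b n))).
  apply: le_trans; rewrite /series/= mulr_sumr; apply: ler_sum => k _.
  by rewrite !normrM normrX mulrA.
- move=> n; rewrite (_ : series _ = (fun K => b n * series (fun k => pw n k * x ^+ k) K)).
    by apply: cvgMl_tmp; exact: (hpw n).1.
  by apply/funext => K; rewrite /series/= mulr_sumr; apply: eq_bigr => k _; rewrite mulrA.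
- move=> k; rewrite [X in X @ _ --> _](_ : _ = (fun N => series (fun n => b n * pw n k) N * x ^+ k)); last first.
    by apply/funext => N; rewrite /series/= mulr_suml.
  apply: cvgMr_tmp.
  (* At radius 1 the weighted norm of [pw n] bounds each of its coefficients, so the series defining
     the k-th coefficient of the composite converges absolutely. *)
  apply: normed_cvg; apply: (@series_le_cvg _ _ (fun n => `|b n| * abs_sum a 1 ^+ n)).
  + by move=> n; exact: normr_ge0.
  + by move=> n; rewrite mulr_ge0// exprn_ge0// (abs_sum_ge0 ah).
  + move=> n /=; rewrite normrM; apply: ler_wpM2l => //.
    apply: le_trans ((hpw n).2 1 k.+1 ler01); rewrite /series/= big_nat_recr//=.
    by rewrite expr1n mulr1 lerDr sumr_ge0// => i _; rewrite mulr_ge0// exprn_ge0.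
  + exact: (power_sum_abs bg).
Qed.

Lemma entireM g h : entire g -> entire h -> entire (fun x => g x * h x).
Proof. by move=> [a ag] [b bh]; exists (cauchy_prod a b); exact: power_sumM. Qed.

Lemma entireD g h : entire g -> entire h -> entire (fun x => g x + h x).
Proof.
move=> [a ag] [b bh]; exists (fun k => a k + b k) => x.
rewrite (_ : series _ = (fun N => series (fun k => a k * x ^+ k) N + series (fun k => b k * x ^+ k) N)).
  by apply: cvgD; [exact: ag | exact: bh].
by apply/funext => N; rewrite /series/= -big_split; apply: eq_bigr => k _; rewrite mulrDl.
Qed.

Lemma entire_cst z : entire (fun=> z : R).
Proof. by eexists; exact: power_sum_cst. Qed.

Lemma entireN g : entire g -> entire (fun x => - g x).
Proof.
move=> /(entireM _ _ (entire_cst (-1))); congr entire; apply/funext => x.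
by rewrite mulN1r.
Qed.

Lemma entire_sum (I : Type) (r : seq I) (P : pred I) (F : I -> R -> R) :
  (forall i, P i -> entire (F i)) -> entire (fun x => \sum_(i <- r | P i) F i x).
Proof.
move=> eF; elim: r => [|i r [a ha]].
  have [a ha] := entire_cst 0; exists a => x; rewrite big_nil; exact: ha.
have [Pi|Pi] := boolP (P i); last first.
  by exists a => x; rewrite big_cons (negbTE Pi); exact: ha.
have [b hb] : entire (fun x => F i x + \sum_(j <- r | P j) F j x).
  by apply: entireD; [exact: eF | exists a].
by exists b => x; rewrite big_cons Pi; exact: hb.
Qed.

Lemma entire_id : entire (@idfun R).
Proof.
exists (fun k => (k == 1%N)%:R) => x; apply: cvg_near_cst; exists 2%N => // N /= N2.
rewrite /series/= (bigD1_seq 1%N)//= ?iota_uniq//; last by rewrite mem_index_iota.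
by rewrite expr1 mul1r big1 ?addr0// => i /negPf ->; rewrite mul0r.
Qed.

Lemma entire_expR : entire (@expR R).
Proof.
exists (fun n => n`!%:R^-1) => x; rewrite -exp_coeffE /expR.
exact: is_cvg_series_exp_coeff.
Qed.

Lemma entire_sin : entire (@sin R).
Proof.
exists (fun n => (odd n)%:R * (-1) ^+ n.-1./2 * (n`!%:R)^-1) => x.
rewrite sin.unlock [X in series X @ _](_ : _ = sin_coeff x) ?sin_coeffE// -sin_coeffE.
exact: is_cvg_series_sin_coeff.
Qed.

Lemma entire_cos : entire (@cos R).
Proof.
exists (fun n => (~~ odd n)%:R * (-1) ^+ n./2 * (n`!%:R)^-1) => x.
rewrite cos.unlock [X in series X @ _](_ : _ = cos_coeff x) ?cos_coeffE// -cos_coeffE.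
exact: is_cvg_series_cos_coeff.
Qed.

Lemma power_sum_cvg {a g} : power_sum a g ->
  forall (x : nat -> R) (l : R), x @ \oo --> l -> (fun N => g (x N)) @ \oo --> g l.
Proof.
move=> ag x l xl.
have [M [Mr xM]] : bounded_fun x by apply: cvg_seq_bounded; apply/cvg_ex; exists l.
pose B := `|M| + 1.
have xB N : `|x N| <= B.
  by apply: xM => //; rewrite (le_lt_trans (ler_norm M))// ltrDl.
apply: (@tannery _ (fun n N => a n * x N ^+ n) (fun n => a n * l ^+ n)
  (fun n => `|a n| * B ^+ n)).
- move=> n; apply: cvgMl_tmp.
  by apply: (@cvg_comp _ _ _ x (fun z => z ^+ n) _ _ _ xl); exact: exprn_continuous.
- move=> n N; rewrite normrM normrX; apply: ler_wpM2l => //.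
  by apply: lerXn2r => //; rewrite nnegrE// /B addr_ge0.
- exact: (power_sum_abs ag).
- by move=> N; exact: ag.
- exact: ag.
Qed.

Lemma power_sum_measurable {a g} : power_sum a g -> measurable_fun setT g.
Proof.
move=> ag; have mS N : measurable_fun setT (fun x : R => series (fun k => a k * x ^+ k) N).
  by apply: measurable_sum => k; apply: measurable_funM => //; exact: measurable_funX.
by apply: (measurable_fun_cvg mS) => x _; exact: ag.
Qed.

Lemma dfact_pred_ge1 k : (1 <= dfact_pred k)%N.
Proof.
suff h n : (1 <= dfact n)%N /\ (1 <= dfact n.+1)%N by case: k => // k; exact: (h k).1.
by elim: n => [|n [h1 h2]]; split => //=; rewrite muln_gt0.
Qed.

(** Root test: (k-1)!! >= 1, so |p_k|^(1/k) tends to 0. The choice eps = 1 / (2 (|x| + 1)) bounds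
    the late terms at x by 2^-n. *)
Lemma negligible_power_sum (p : nat -> R) :
  negligible_dfact p -> power_sum p (pow_series p).
Proof.
move=> hp x; apply: normed_cvg.
have e0 : 0 < (2 * (`|x| + 1))^-1 by rewrite invr_gt0 mulr_gt0// ltr_wpDl.
have [N _ hN] := hp _ e0.
(* Starting at [N.+1] keeps the exponent n nonzero, so that the n-th root can be undone. *)
pose q k := p (k + N.+1)%N * x ^+ (k + N.+1).
suff : cvgn (series (fun k => `|q k|)).
  move=> cq; rewrite /normed_series_of -(is_cvg_series_restrict N.+1).
  apply/cvg_ex; exists (limn (series (fun k => `|q k|))); rewrite -(cvg_shiftn N.+1).
  rewrite [X in X @ _ --> _](_ : _ = series (fun k => `|q k|))//.
  by apply/funext => K; rewrite /series/= -{1}[N.+1]add0n big_addn addnK.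
apply: (@series_le_cvg _ _ (geometric 1 2^-1)) => //.
- by move=> k /=; rewrite mul1r exprn_ge0.
- move=> k /=; rewrite mul1r /q; set n := (k + N.+1)%N.
  have := hN n; rewrite /= /n addnS => /(_ (leq_trans (leq_addl _ _) (leqnSn _))).
  rewrite -addnS -/n => hn.
  have n0 : n%:R != 0 :> R by rewrite pnatr_eq0 /n addnS.
  have hpn : `|p n| <= (2 * (`|x| + 1))^-1 ^+ n.
    apply: (@le_trans _ _ (`|p n| * (dfact_pred n)%:R)).
      by rewrite ler_peMr// ler1n dfact_pred_ge1.
    rewrite -(powR_mulrn n (ltW e0)).
    have -> : `|p n| * (dfact_pred n)%:R
        = ((`|p n| * (dfact_pred n)%:R) `^ n%:R^-1) `^ n%:R.
      by rewrite -powRrM mulVf// powRr1// mulr_ge0.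
    by apply: (ge0_ler_powR (ler0n _ n)); rewrite ?nnegrE ?powR_ge0 ?(ltW e0).
  rewrite normrM normrX; apply: (@le_trans _ _ ((2 * (`|x| + 1))^-1 ^+ n * (`|x| + 1) ^+ n)).
    by apply: ler_pM; rewrite ?exprn_ge0//; apply: lerXn2r; rewrite ?nnegrE ?lerDl ?addr_ge0.
  rewrite -exprMn invfM mulfVK; last by rewrite gt_eqF// ltr_wpDl.
  by rewrite /n exprD ler_piMr ?exprn_ge0// exprn_ile1// invf_le1 ?ler1n.
- by apply: is_cvg_geometric_series; rewrite ger0_norm ?invr_ge0// invf_lt1 ?ltr1n.
Qed.

End entire_closure.

(** * Finite-dimensional Cameron-Martin formula *)

Section integral_density_transfer.
Local Open Scope ereal_scope.
Context {R : realType}.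

Import HBNNSimple.

Section simple.
Context {d1 d} {T : measurableType d1} {S : measurableType d}.
Variables (mu : {measure set T -> \bar R}) (X : T -> S) (g : T -> R).
Hypotheses (mX : measurable_fun setT X) (mg : measurable_fun setT g).
Hypothesis (g0 : forall x, (0 <= g x)%R).

Let preim B : measurable B -> measurable (X @^-1` B).
Proof. by move=> mB; rewrite -[_ @^-1` _]setTI; exact: mX. Qed.

Lemma ge0_integral_nnsfun_density (f : {nnsfun S >-> R}) :
  \int[mu]_x (f (X x) * g x)%:E =
  \sum_(r \in range f) r%:E * \int[mu]_(x in X @^-1` (f @^-1` [set r])) (g x)%:E.
Proof.
have mi (r : R) : measurable_fun setT (fun x => \1_(f @^-1` [set r]) (X x) : R).
  exact: measurableT_comp.
transitivity (\sum_(r \in range f)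
    \int[mu]_x (r * \1_(f @^-1` [set r]) (X x) * g x)%:E).
  rewrite -ge0_integral_fsum//.
  - apply: eq_integral => x _; rewrite fsumEFin// [in LHS]fimfunE.
    by rewrite mulr_fsuml.
  - move=> r; apply/measurable_EFinP; apply: measurable_funM => //.
    exact: measurable_funM.
  - move=> r x _; rewrite lee_fin; apply: mulr_ge0 => //.
    by have := nnfun_muleindic_ge0 f r (X x); rewrite -EFinM lee_fin.
apply: eq_fsbigr => r _.
rewrite [in RHS]integral_mkcond.
rewrite (_ : (fun x => (g x)%:E) \_ _ =
    fun x => (\1_(f @^-1` [set r]) (X x) * g x)%:E); last first.
  apply/funext => x; rewrite patchE /indic.
  have [h|h] := pselect ((f @^-1` [set r]) (X x)).
    by rewrite !mem_set// mul1r.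
  by rewrite !memNset// mul0r.
have [r0|r0] := leP 0%R r.
  rewrite -ge0_integralZl//.
  - by apply: eq_integral => x _; rewrite -EFinM mulrA.
  - by apply/measurable_EFinP; exact: measurable_funM.
  - by move=> x _; rewrite lee_fin mulr_ge0.
(* A negative r is not a value of the nonnegative simple function, so both integrals vanish. *)
rewrite preimage_nnfun0// !integral0_eq ?mule0// => x _; rewrite indic0 ?mulr0 ?mul0r//.
Qed.

End simple.

(** Equality of the two weighted image measures passes to simple functions and then, by monotone
    convergence, to [phi]. Two distinct source spaces are allowed so that a probability can be
    compared with Lebesgue measure weighted by a density. *)
Lemma ge0_integral_density_eq d1 d2 d (T1 : measurableType d1) (T2 : measurableType d2)
  (S : measurableType d) (mu1 : {measure set T1 -> \bar R}) (mu2 : {measure set T2 -> \bar R})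
  (X1 : T1 -> S) (X2 : T2 -> S) (g1 : T1 -> R) (g2 : T2 -> R) :
  measurable_fun setT X1 -> measurable_fun setT X2 ->
  measurable_fun setT g1 -> measurable_fun setT g2 ->
  (forall x, 0 <= g1 x)%R -> (forall x, 0 <= g2 x)%R ->
  (forall B, measurable B ->
     \int[mu1]_(x in X1 @^-1` B) (g1 x)%:E = \int[mu2]_(x in X2 @^-1` B) (g2 x)%:E) ->
  forall phi : S -> R, measurable_fun setT phi -> (forall y, 0 <= phi y)%R ->
  \int[mu1]_x (phi (X1 x) * g1 x)%:E = \int[mu2]_x (phi (X2 x) * g2 x)%:E.
Proof.
move=> mX1 mX2 mg1 mg2 g10 g20 h phi mphi phi0.
have mphiE : measurable_fun setT (EFin \o phi) by exact/measurable_EFinP.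
pose f_ := nnsfun_approx measurableT mphiE.
have H d' (T : measurableType d') (mu : {measure set T -> \bar R}) (X : T -> S) (g : T -> R) :
    measurable_fun setT X -> measurable_fun setT g -> (forall x, 0 <= g x)%R ->
    \int[mu]_x (phi (X x) * g x)%:E = limn (fun n => \int[mu]_x (f_ n (X x) * g x)%:E).
  move=> mX mg g0; rewrite -monotone_convergence//.
  - apply: eq_integral => x _; apply/esym/cvg_lim => //; rewrite EFinM.
    under eq_fun do rewrite EFinM.
    apply: cvgeZr => //; apply: cvg_nnsfun_approx => // y _.
    by rewrite /= lee_fin.
  - by move=> n; apply/measurable_EFinP; apply: measurable_funM => //; exact: measurableT_comp.
  - by move=> n x _; rewrite lee_fin mulr_ge0.
  - move=> x _ m n mn; rewrite lee_fin ler_wpM2r//.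
    by apply/lefP; exact: nd_nnsfun_approx.
rewrite !H//; congr (limn _); apply/funext => n.
rewrite !ge0_integral_nnsfun_density//; apply: eq_fsbigr => r _; congr (_ * _).
by apply: h.
Qed.

(** The extended integral is the difference of those of the positive and negative parts, and a
    nonnegative weight commutes with taking these parts; no integrability enters. *)
Lemma integral_density_eq d1 d2 d (T1 : measurableType d1) (T2 : measurableType d2)
  (S : measurableType d) (mu1 : {measure set T1 -> \bar R}) (mu2 : {measure set T2 -> \bar R})
  (X1 : T1 -> S) (X2 : T2 -> S) (g1 : T1 -> R) (g2 : T2 -> R) :
  measurable_fun setT X1 -> measurable_fun setT X2 ->
  measurable_fun setT g1 -> measurable_fun setT g2 ->
  (forall x, 0 <= g1 x)%R -> (forall x, 0 <= g2 x)%R ->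
  (forall B, measurable B ->
     \int[mu1]_(x in X1 @^-1` B) (g1 x)%:E = \int[mu2]_(x in X2 @^-1` B) (g2 x)%:E) ->
  forall phi : S -> R, measurable_fun setT phi ->
  \int[mu1]_x (phi (X1 x) * g1 x)%:E = \int[mu2]_x (phi (X2 x) * g2 x)%:E.
Proof.
move=> mX1 mX2 mg1 mg2 g10 g20 h phi mphi.
have P d' (T : measurableType d') (X : T -> S) (g : T -> R) : (forall x, 0 <= g x)%R ->
    ((fun x => (phi (X x) * g x)%:E)^\+ = fun x => (phi^\+%R (X x) * g x)%:E) /\
    ((fun x => (phi (X x) * g x)%:E)^\- = fun x => (phi^\-%R (X x) * g x)%:E).
  move=> g0; split; apply/funext => x; rewrite ?funeposE ?funenegE ?funrposE ?funrnegE.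
    by rewrite -EFin_max maxr_pMl// mul0r.
  by rewrite -EFinN -EFin_max maxr_pMl// mul0r mulNr.
rewrite integralE [RHS]integralE.
rewrite (P _ _ _ _ g10).1 (P _ _ _ _ g10).2 (P _ _ _ _ g20).1 (P _ _ _ _ g20).2.
congr (_ - _); apply: ge0_integral_density_eq => //.
- exact: measurable_funrpos.
- exact: measurable_funrneg.
Qed.

End integral_density_transfer.

Section image_density.
Local Open Scope ereal_scope.
Context {R : realType} {d1 d} {T : measurableType d1} {S : measurableType d}.
Variables (mu : {measure set T -> \bar R}) (X : T -> S) (g : T -> R).

(** The image under X of the measure with density g. The proofs are arguments so that the measure
    instance can be inferred from the term itself. *)
Definition image_density (mX : measurable_fun setT X) (mg : measurable_fun setT g)
    (g0 : forall x, (0 <= g x)%R) (B : set S) : \bar R :=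
  \int[mu]_(x in X @^-1` B) (g x)%:E.

Hypotheses (mX : measurable_fun setT X) (mg : measurable_fun setT g).
Hypothesis (g0 : forall x, (0 <= g x)%R).

Let nu0 : image_density mX mg g0 set0 = 0.
Proof. by rewrite /image_density preimage_set0 integral_set0. Qed.

Let nu_ge0 B : 0 <= image_density mX mg g0 B.
Proof. by apply: integral_ge0 => x _; rewrite lee_fin. Qed.

Let nu_sigma_additive : semi_sigma_additive (image_density mX mg g0).
Proof.
move=> F mF tF mUF; rewrite /image_density preimage_bigcup.
rewrite ge0_integral_bigcup//.
- by apply: is_cvg_ereal_nneg_natsum_cond => n _ _; exact: nu_ge0.
- by move=> n; rewrite -[_ @^-1` _]setTI; exact: mX.
- by apply: measurable_funTS; exact/measurable_EFinP.
- by move=> x _; rewrite lee_fin.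
- by apply/trivIsetP => i j _ _ ij; rewrite -preimage_setI;
    move/trivIsetP : tF => ->//; rewrite preimage_set0.
Qed.

HB.instance Definition _ := isMeasure.Build _ _ _
  (image_density mX mg g0) nu0 nu_ge0 nu_sigma_additive.

End image_density.

(** Pi-lambda uniqueness; the whole space lies in [G] and has finite mass, so it serves as a
    constant exhausting sequence. *)
Lemma image_density_unique {R : realType} d1 d2 (T1 : measurableType d1)
  (T2 : measurableType d2) (U : pointedType) (G : set (set U))
  (mu1 : {measure set T1 -> \bar R}) (mu2 : {measure set T2 -> \bar R})
  (X1 : T1 -> g_sigma_algebraType G) (X2 : T2 -> g_sigma_algebraType G)
  (g1 : T1 -> R) (g2 : T2 -> R) :
  measurable_fun setT X1 -> measurable_fun setT X2 ->
  measurable_fun setT g1 -> measurable_fun setT g2 ->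
  (forall x, 0 <= g1 x) -> (forall x, 0 <= g2 x) ->
  setI_closed G -> G setT -> (\int[mu1]_x (g1 x)%:E < +oo)%E ->
  (forall B, G B -> (\int[mu1]_(x in X1 @^-1` B) (g1 x)%:E =
                     \int[mu2]_(x in X2 @^-1` B) (g2 x)%:E)%E) ->
  forall B : set (g_sigma_algebraType G), measurable B ->
  (\int[mu1]_(x in X1 @^-1` B) (g1 x)%:E = \int[mu2]_(x in X2 @^-1` B) (g2 x)%:E)%E.
Proof.
move=> mX1 mX2 mg1 mg2 g10 g20 GI GT fin h B mB.
rewrite -[LHS]/(image_density mu1 X1 g1 mX1 mg1 g10 B) -[RHS]/(image_density mu2 X2 g2 mX2 mg2 g20 B).
apply: (@g_sigma_algebra_measure_unique _ R (g_sigma_algebraType G) G _ (fun=> setT)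
  _ _ (image_density mu1 X1 g1 mX1 mg1 g10) (image_density mu2 X2 g2 mX2 mg2 g20)) => //.
- exact: sub_sigma_algebra.
- by rewrite bigcup_const//; exists 0%N.
Qed.

(** * Translation and exponential tilting of one Gaussian variable *)

Section gaussian_shift.
Context {R : realType}.
Local Notation leb := (@lebesgue_measure R).

Lemma lebesgue_measureD (m : R) (A : set R) : measurable A ->
  pushforward leb ((fun x => x + m) : _ -> measurableTypeR R) A = leb A.
Proof.
move=> mA; apply/esym/lebesgue_measure_unique => //=.
  have h : measurable_fun setT (fun x : R => x + m) by exact: measurable_funD.
  exact: h.
move=> _ _ [[a b]] _ <-.
rewrite /pushforward (_ : _ @^-1` _ = `]a - m, b - m]%classic).
  by rewrite !lebesgue_measure_itv/= !lte_fin ltrD2r -!EFinB; congr (if _ then _%:E else _); ring.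
by apply/seteqP; split => x /=; rewrite !in_itv/= ltrBlDr lerBrDr.
Qed.

Lemma normal_probD (m s : R) (A : set R) : s != 0 -> measurable A ->
  normal_prob m s A = normal_prob 0 s ((fun x => x + m) @^-1` A).
Proof.
move=> s0 mA; rewrite /normal_prob.
transitivity (\int[pushforward leb ((fun x : R => (x + m)%R) : _ -> measurableTypeR R)]_(x in A) (normal_pdf m s x)%:E)%E.
  apply: eq_measure_integral.
    have h : measurable_fun setT (fun x : R => x + m) by exact: measurable_funD.
    exact: h.
  by move=> h B mB _; exact/esym/(lebesgue_measureD m B mB).
rewrite ge0_integral_pushforward//=.
- by apply: eq_integral => x _; rewrite /= !normal_pdfE// /normal_fun addrK subr0.
- exact: measurable_funD.
- by apply/measurable_EFinP/measurable_funTS; exact: measurable_normal_pdf.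
- by move=> x _; rewrite lee_fin normal_pdf_ge0.
Qed.

(** Completing the square: k y - k^2 v / 2 - y^2 / (2 v) = - (y - k v)^2 / (2 v), so the tilted
    density is that of mean k v and variance v. The scale parameter of [normal_prob] is the standard
    deviation, hence the square roots. *)
Lemma gaussian_tilt d (Om : measurableType d) (P : probability Om R) (X : Om -> R)
  (v k : R) : 0 < v -> measurable_fun setT X ->
  (forall B, measurable B -> P (X @^-1` B) = normal_prob 0 (Num.sqrt v) B) ->
  forall B, measurable B ->
  (\int[P]_(w in X @^-1` B) (expR (k * X w - k ^+ 2 * v / 2)%R)%:E =
   P ((fun w => X w + k * v)%R @^-1` B))%E.
Proof.
move=> v0 mX lawX B mB.
have s0 : Num.sqrt v != 0 by rewrite gt_eqF// sqrtr_gt0.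
have mB' : measurable ((fun x => x + k * v) @^-1` B).
  by rewrite -[_ @^-1` _]setTI; apply: measurable_funD.
rewrite [RHS](lawX _ mB') -normal_probD//.
rewrite integral_mkcond /normal_prob [RHS]integral_mkcond.
pose phi (y : R) : R := expR (k * y - k ^+ 2 * v / 2) * \1_B y.
have mphi : measurable_fun setT phi.
  apply: measurable_funM => //; apply: measurableT_comp => //.
  by apply: measurable_funB => //; exact: measurable_funM.
transitivity (\int[P]_w (phi (X w) * 1)%:E)%E.
  apply: eq_integral => w _; rewrite mulr1 /phi patchE /indic.
  have [h|h] := pselect (B (X w)); first by rewrite !mem_set// mulr1.
  by rewrite !memNset// mulr0.
have mpdf : measurable_fun setT (normal_pdf 0 (Num.sqrt v)) by exact: measurable_normal_pdf.
transitivity (\int[leb]_y (phi y * normal_pdf 0 (Num.sqrt v) y)%:E)%E.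
  apply: (@ge0_integral_density_eq R _ _ _ Om (measurableTypeR R) (measurableTypeR R) P leb X idfun (fun=> 1)
    (normal_pdf 0 (Num.sqrt v))) => //.
  - exact: measurable_id.
  - by move=> x; exact: normal_pdf_ge0.
  - move=> C mC; rewrite integral_cst ?mul1e; last first.
      by rewrite -[_ @^-1` _]setTI; exact: mX.
    exact: lawX.
  - by move=> y; rewrite mulr_ge0// expR_ge0.
apply: eq_integral => y _; rewrite /phi patchE /indic.
have [h|h] := pselect (B y); last by rewrite !memNset// mulr0 mul0r.
rewrite !mem_set// mulr1 !normal_pdfE// mulrCA -expRD /normal_fun sqr_sqrtr ?ltW//.
congr (_ * expR _)%:E; field; exact: lt0r_neq0.
Qed.

End gaussian_shift.

(** * The cylinder sigma-algebra on real sequences *)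

Section cylinders.
Context {R : realType}.

(** Rectangles in finitely many initial coordinates form a pi-system. Working with infinite
    sequences gives one fixed space for the increments of every mesh, whatever their number. *)
Definition cylinder : set (set (nat -> R)) :=
  [set A | exists (k : nat) (B : nat -> set R), (forall i, measurable (B i)) /\
     A = [set f | forall i, (i < k)%N -> B i (f i)]].

Lemma cylinder_setI : setI_closed cylinder.
Proof.
move=> _ _ [k [B [mB ->]]] [l [C [mC ->]]].
exists (maxn k l), (fun i => (if (i < k)%N then B i else setT) `&`
                            (if (i < l)%N then C i else setT)); split.
  by move=> i; apply: measurableI; case: ifP.
apply/seteqP; split => [f [fB fC] i _|f h].
  by split; case: ifP => // il; [exact: fB | exact: fC].
split => i il; have := h i.
- by rewrite leq_max il => /(_ isT) [].
- by rewrite leq_max il orbT => /(_ isT) [].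
Qed.

Lemma measurable_coord i :
  measurable_fun setT (fun f : g_sigma_algebraType cylinder => f i).
Proof.
move=> _ B mB; rewrite setTI; apply: sub_sigma_algebra.
exists i.+1, (fun j => if j == i then B else setT); split.
  by move=> j; case: ifP.
apply/seteqP; split => [f fB j _|f /(_ i (ltnSn i))]; first by case: eqP => // ->.
by rewrite eqxx.
Qed.

Lemma measurable_to_cylinder d (Om : measurableType d) (X : nat -> Om -> R) :
  (forall i, measurable_fun setT (X i)) ->
  measurable_fun setT (fun w => (fun i => X i w) : g_sigma_algebraType cylinder).
Proof.
move=> mX; apply: (@measurability _ _ Om (g_sigma_algebraType cylinder) setT _ cylinder) => //.
move=> _ [_ [k [B [mB ->]]] <-].
rewrite setTI (_ : _ @^-1` _ = \bigcap_(i in [set i | (i < k)%N]) (X i @^-1` B i)).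
  apply: bigcap_measurableType.
  by move=> i _; rewrite -[_ @^-1` _]setTI; exact: mX.
by apply/seteqP; split.
Qed.

End cylinders.

Lemma integral_set_indic {R : realType} d (T : measurableType d)
  (mu : {measure set T -> \bar R}) (A : set T) (f : T -> R) :
  (\int[mu]_(x in A) (f x)%:E = \int[mu]_x (\1_A x * f x)%:E)%E.
Proof.
rewrite integral_mkcond; apply: eq_integral => x _; rewrite patchE indicE.
by case: (x \in A); rewrite ?mul1r ?mul0r.
Qed.

Section gaussian_vector_shift.
Context {R : realType} {d} {Om : measurableType d} (P : probability Om R).
Variables (D : nat -> Om -> R) (v kap : nat -> R).
Hypothesis mD : forall i, measurable_fun setT (D i).
Hypothesis v0 : forall i, 0 < v i.
Hypothesis lawD : forall i B, measurable B ->
  P (D i @^-1` B) = normal_prob 0 (Num.sqrt (v i)) B.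
Hypothesis indepD : forall k (B : nat -> set R), (forall i, measurable (B i)) ->
  P (\bigcap_(i in [set i | (i < k)%N]) (D i @^-1` B i)) =
  \big[*%E/1%E]_(i < k) P (D i @^-1` B i).

Let phi i w := expR (kap i * D i w - kap i ^+ 2 * v i / 2).

Let mphi i : measurable_fun setT (phi i).
Proof.
apply: measurableT_comp => //; apply: measurable_funB => //.
exact: measurable_funM.
Qed.

Let mpre i (B : set R) : measurable B -> measurable (D i @^-1` B).
Proof. by move=> mB; rewrite -[_ @^-1` _]setTI; exact: mD. Qed.

Let rect k (B : nat -> set R) := \bigcap_(i in [set i | (i < k)%N]) (D i @^-1` B i).

Let mrect k B : (forall i, measurable (B i)) -> measurable (rect k B).
Proof.
by move=> mB; apply: bigcap_measurableType => i _; exact: mpre.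
Qed.

(* The [m]-th coordinate is tilted by integrating out the others, which leaves
   the law of [D m] times a constant. *)
Lemma integral_tilt_rect m k (B : nat -> set R) : (m <= k)%N ->
  (forall i, measurable (B i)) ->
  (\int[P]_(w in rect k B) (\prod_(i < m) phi i w)%:E =
   \big[*%E/1%E]_(i < k) (if (i < m)%N then P ((fun w => (D i w + kap i * v i)%R) @^-1` B i)
                          else P (D i @^-1` B i)))%E.
Proof.
elim: m B => [|m IH] B mk mB.
  under eq_integral do rewrite big_ord0.
  by rewrite integral_cst ?mul1e; [exact: indepD | exact: mrect].
pose om : 'I_k := Ordinal mk.
(* Replacing the m-th side of the rectangle by an arbitrary C lets the induction hypothesis describe
   the whole law of [D m] under the weight built from the first m tilts. *)
pose B_ (C : set R) i := if i == m then C else B i.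
have mB_ C : measurable C -> forall i, measurable (B_ C i).
  by move=> mC i; rewrite /B_; case: ifP.
have rectE C : rect k (B_ C) = D m @^-1` C `&` rect k (B_ setT).
  apply/seteqP; split => [w h|w [h1 h2] i /= ik].
    split; first by have := h m mk; rewrite /B_ /= eqxx.
    by move=> i ik; have := h i ik; rewrite /B_ /=; case: eqP.
  by have := h2 i ik; rewrite /B_ /=; case: eqP => // ->.
pose be i := (if (i < m)%N then P ((fun w => (D i w + kap i * v i)%R) @^-1` B i)
                          else P (D i @^-1` B i)).
pose c := (\big[*%E/1%E]_(i < k | i != om) be i)%E.
have mshift i : measurable ((fun w => D i w + kap i * v i) @^-1` B i).
  by rewrite -[_ @^-1` _]setTI; apply: measurable_funD.
have be_fin i : be i \is a fin_num.
  by rewrite /be; case: ifP => _; apply: fin_num_measure => //; exact: mpre.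
have be0 i : (0 <= be i)%E by rewrite /be; case: ifP.
have c_fin : c \is a fin_num.
  by rewrite /c; elim/big_ind : _ => // x y hx hy; exact: fin_numM.
have c0 : (0 <= c)%E by rewrite /c; apply: prode_ge0.
pose g1 w := \1_(rect k (B_ setT)) w * \prod_(i < m) phi i w.
have mprod j : measurable_fun setT (fun w => \prod_(i < j) phi i w).
  by apply: measurable_prod.
have mg1 : measurable_fun setT g1.
  by apply: measurable_funM => //; apply: measurable_indic; apply: mrect; exact: mB_.
have g10 w : 0 <= g1 w.
  by rewrite mulr_ge0// prodr_ge0// => i _; exact: expR_ge0.
have key C : measurable C ->
    (\int[P]_(w in D m @^-1` C) (g1 w)%:E = \int[P]_(w in D m @^-1` C) (fine c)%:E)%E.
  move=> mC; rewrite integral_cst; last exact: mpre.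
  transitivity (\int[P]_(w in rect k (B_ C)) (\prod_(i < m) phi i w)%:E)%E.
    rewrite integral_set_indic [RHS]integral_set_indic; apply: eq_integral => w _.
    by rewrite rectE indicI /g1 mulrA.
  rewrite IH ?(ltnW mk)//; last exact: mB_.
  rewrite (bigD1 om)//= ltnn /B_ eqxx muleC fineK//; congr (_ * _)%E.
  by apply: eq_bigr => i im; rewrite (_ : (i == m :> nat) = false)//; apply/negbTE.
pose psi (y : R) := \1_(B m) y * expR (kap m * y - kap m ^+ 2 * v m / 2).
have mpsi : measurable_fun setT psi.
  apply: measurable_funM => //; apply: measurableT_comp => //.
  by apply: measurable_funB => //; exact: measurable_funM.
have psi0 y : 0 <= psi y by rewrite mulr_ge0 ?expR_ge0.
have := @ge0_integral_density_eq R _ _ _ _ _ _ P P (D m) (D m) g1 (fun=> fine c)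
  (mD m) (mD m) mg1 (measurable_cst _) g10 (fun=> fine_ge0 c0) key psi mpsi psi0.
move=> h; rewrite [in RHS](bigD1 om)//= ltnSn.
have indE w : \1_(D m @^-1` B m) w = \1_(B m) (D m w) :> R by [].
transitivity (\int[P]_x (psi (D m x) * g1 x)%:E)%E.
  rewrite [LHS]integral_set_indic; apply: eq_integral => w _.
  rewrite (_ : rect k B = rect k (B_ (B m))); last first.
    apply/seteqP; split => w' h' i ik; have := h' i ik; rewrite /B_ /=; case: eqP => // ->//.
  rewrite rectE indicI /psi /g1 big_ord_recr/= indE.
  by congr _%:E; rewrite /phi; ring.
rewrite h.
transitivity ((fine c)%:E * \int[P]_(w in D m @^-1` B m) (phi m w)%:E)%E.
  rewrite [in RHS]integral_set_indic -ge0_integralZl//.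
  - by apply: eq_integral => w _; rewrite -EFinM mulrC /psi indE.
  - apply/measurable_EFinP/measurable_funM => //; apply: measurable_indic; exact: mpre.
  - by move=> w _; rewrite lee_fin mulr_ge0// expR_ge0.
  - by rewrite lee_fin fine_ge0.
rewrite fineK// muleC (gaussian_tilt _ _ _ _ _ _ (v0 m) (mD m) (lawD m))//.
congr (_ * _)%E; apply: eq_bigr => i im; rewrite /be [in RHS]ltnS [in RHS]leq_eqVlt.
by rewrite (_ : (i == m :> nat) = false)//; apply/negbTE.
Qed.

(** Both sides integrate [F] against weighted image laws on sequence space. On rectangles the left
    one factors by independence and the right one by [integral_tilt_rect]; pi-lambda uniqueness then
    gives all measurable sets. *)
Lemma gaussian_vector_shift M : (forall i, (M <= i)%N -> kap i = 0) ->
  forall F : g_sigma_algebraType (@cylinder R) -> R, measurable_fun setT F ->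
  (\int[P]_w (F (fun i => (D i w + kap i * v i)%R))%:E =
   \int[P]_w (F (fun i => D i w) * \prod_(i < M) phi i w)%:E)%E.
Proof.
move=> kap0 F mF.
have mprod j : measurable_fun setT (fun w => \prod_(i < j) phi i w).
  by apply: measurable_prod.
have mX1 : measurable_fun setT (fun w => (fun i => D i w + kap i * v i) : g_sigma_algebraType (@cylinder R)).
  by apply: (measurable_to_cylinder _ _ (fun i w => D i w + kap i * v i)) => i; apply: measurable_funD.
have mX2 := measurable_to_cylinder _ _ D mD.
have Z0 w : 0 <= \prod_(i < M) phi i w by rewrite prodr_ge0// => i _; exact: expR_ge0.
transitivity (\int[P]_w (F (fun i => (D i w + kap i * v i)%R) * 1)%:E)%E.
  by apply: eq_integral => w _; rewrite mulr1.
apply: (@integral_density_eq R _ _ _ _ _ _ P P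
  (fun w => (fun i => D i w + kap i * v i) : g_sigma_algebraType (@cylinder R))
  (fun w => (fun i => D i w) : g_sigma_algebraType (@cylinder R)) (fun=> 1)
  (fun w => \prod_(i < M) phi i w)) => //.
apply: image_density_unique => //.
- exact: cylinder_setI.
- by exists 0%N, (fun=> setT); split => //; apply/seteqP; split.
- by rewrite integral_cst// mul1e (le_lt_trans (probability_le1 P measurableT)) ?ltry.
move=> _ [k [B [mB ->]]].
pose B' i := if (i < k)%N then B i else setT.
have mB' i : measurable (B' i) by rewrite /B'; case: ifP.
(* Every tilted coordinate must be among the constrained ones. The sides added to the rectangle are
   [setT], and the tilts added to the product equal 1 because [kap] vanishes from M on. *)
pose k' := maxn M k.
have pre (X : nat -> Om -> R) : (fun w => (fun i => X i w)) @^-1`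
      [set f | forall i, (i < k)%N -> B i (f i)] =
    \bigcap_(i in [set i | (i < k')%N]) (X i @^-1` B' i).
  apply/seteqP; split => w h i ik; rewrite /B'/=.
    by case: ifP => // /h.
  by have := h i; rewrite /= leq_max ik orbT /B' ik => /(_ isT).
rewrite (pre (fun i w => D i w + kap i * v i)) (pre D).
rewrite (_ : (fun w => (\prod_(i < M) phi i w)%:E) = (fun w => (\prod_(i < k') phi i w)%:E)); last first.
  apply/funext => w; congr _%:E; rewrite -!(big_mkord xpredT (phi ^~ w)).
  rewrite [RHS](big_cat_nat (n := M))/= ?leq_maxl// [X in _ * X]big_nat_cond [X in _ * X]big1 ?mulr1//.
  by move=> i /andP[/andP[Mi _] _]; rewrite /phi kap0// mul0r expr0n/= !mul0r subrr expR0.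
rewrite (integral_tilt_rect _ _ _ (leqnn k') mB').
pose C i := (fun y => y + kap i * v i) @^-1` B' i.
have mC i : measurable (C i).
  by rewrite -[C i]setTI; apply: measurable_funD.
rewrite integral_cst ?mul1e; last exact: (mrect k' C mC).
rewrite [LHS](indepD k' C mC); apply: eq_bigr => i _.
by rewrite ltn_ord.
Qed.

End gaussian_vector_shift.

(** * Euler scheme *)

(** Heine-Cantor, from the near-covering form of compactness with the filter of small positive eta
    as parameter. *)
Lemma segment_uniform_continuity {R : realType} (f : R -> R) (a b e : R) :
  {within `[a, b], continuous f} -> 0 < e ->
  exists2 eta, 0 < eta & forall x y, x \in `[a, b] -> y \in `[a, b] ->
    `|x - y| < eta -> `|f x - f y| < e.
Proof.
move=> cf e0.
have /compact_near_coveringP cov := @segment_compact R a b.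
have [r /= r0 hr] : \forall eta \near (0:R)^'+, `[a, b]%classic `<=`
    (fun x => x \in `[a, b] -> forall y, y \in `[a, b] -> `|x - y| < eta -> `|f x - f y| < e).
  apply: cov => x abx.
  have e20 : 0 < e / 2 by rewrite divr_gt0.
  move/subspace_continuousP : cf => /(_ x abx)/cvgrPdist_lt/(_ _ e20).
  rewrite near_withinE => /nbhs_ballP[r /= r0 hr].
  have r20 : 0 < r / 2 by rewrite divr_gt0.
  near=> x' eta => /= abx' y aby xy.
  have xx' : `|x - x'| < r / 2.
    by near: x'; apply: nbhsx_ballx.
  have er : eta < r / 2 by near: eta; exact: nbhs_right_lt.
  have h1 : `|f x - f x'| < e / 2.
    apply: hr => //; rewrite /ball/=; apply: lt_trans xx' _.
    by rewrite ltr_pdivrMr// ltr_pMr// ltr1n.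
  have h2 : `|f x - f y| < e / 2.
    apply: hr => //; rewrite /ball/=.
    apply: le_lt_trans (ler_distD x' x y) _; rewrite (splitr r) ltrD//.
    exact: lt_trans xy er.
  apply: le_lt_trans (ler_distD (f x) (f x') (f y)) _.
  by rewrite (splitr e) ltrD// distrC.
exists (r / 2); first by rewrite divr_gt0.
move=> x y abx aby xy; apply: (hr (r / 2)) => //=.
  by rewrite sub0r normrN gtr0_norm ?divr_gt0// ltr_pdivrMr// ltr_pMr// ltr1n.
by rewrite divr_gt0.
Unshelve. all: by end_near. Qed.

Section euler.
Context {R : realType}.
Local Notation leb := (@lebesgue_measure R).

(** The increments are an arbitrary sequence, so the same recursion serves Brownian increments,
    shifted increments and the coordinates of sequence space. *)
Fixpoint euler (a b c : R) (del dw : nat -> R) (x : R) (j : nat) : R :=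
  if j is i.+1 then
    let y := euler a b c del dw x i in y + (a + b * y) * del i + c * dw i
  else x.

Variables (a b c t T x : R) (w y : R -> R).
Hypothesis cy : {within `[t, T], continuous y}.
Hypothesis yE : forall s, t <= s <= T ->
  y s = x + Rintegral leb `[t, s] (fun r => a + b * y r) + c * (w s - w t).

(** The noise is additive, so one step reproduces it exactly; the only error is the integral of b
    (y_r - y_u), due to freezing the drift at u. *)
Lemma sde_step (u v om : R) : t <= u -> u <= v -> v <= T ->
  (forall r, u <= r <= v -> `|y r - y u| <= om) ->
  `|y v - (y u + (a + b * y u) * (v - u) + c * (w v - w u))| <= `|b| * om * (v - u).
Proof.
move=> tu uv vT hom.
have tv := le_trans tu uv; have uT := le_trans uv vT.
rewrite (yE v) ?tv// [X in _ - (X + _ + _)](yE u) ?tu//.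
have cf : {within `[t, v], continuous (fun r => a + b * y r)}.
  have cy' : {within `[t, v], continuous y}.
    apply: continuous_subspaceW cy => r /=; rewrite !in_itv/= => /andP[-> /= rv].
    exact: le_trans vT.
  move=> r; apply: cvgD; first exact: cvg_cst.
  by apply: cvgM; [exact: cvg_cst | exact: cy'].
have intf : leb.-integrable `[t, v] (EFin \o (fun r => a + b * y r)).
  by apply: continuous_compact_integrable => //; exact: segment_compact.
have intf' : leb.-integrable `]u, v] (EFin \o (fun r => a + b * y r)).
  apply: integrableS intf => //; apply: subset_itv; rewrite ?bnd_simp//.
have intc (k : R) : leb.-integrable `]u, v] (EFin \o (fun=> k)).
  apply/integrableP; split; first exact/measurable_EFinP.
  under eq_integral do rewrite /=.
  by rewrite integral_cst//= lebesgue_measure_itv/=; case: ifP => _; rewrite ?mule0 ?ltry// -EFinB -EFinM ltry.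
have len : fine (leb `]u, v]) = v - u.
  rewrite lebesgue_measure_itv/= lte_fin; case: ltP => // vu.
  by rewrite (_ : v = u) ?subrr//; apply/eqP; rewrite eq_le vu.
have cst (k : R) : Rintegral leb `]u, v] (fun=> k) = k * (v - u).
  by rewrite Rintegral_cst// len.
have := @Rintegral_itvB R (fun r => a + b * y r) (BLeft t) (BRight v) u intf.
rewrite !bnd_simp => /(_ tu uv).
set I1 := Rintegral _ _ _; set I2 := Rintegral _ _ _; set I3 := Rintegral _ _ _ => IE.
have : `|I3 - (a + b * y u) * (v - u)| <= `|b| * om * (v - u).
  rewrite -cst /I3 -RintegralB//; apply: le_trans (le_normr_Rintegral _ _) _ => //.
    exact: (integrableB _ intf' (intc _)).
  rewrite -cst; apply: le_Rintegral => //.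
    by apply: integrable_norm; exact: (integrableB _ intf' (intc _)).
  move=> r /=; rewrite in_itv/= => /andP[ur rv].
  rewrite (_ : _ - _ = b * (y r - y u)); last by ring.
  by rewrite normrM ler_wpM2l// hom// (ltW ur).
apply: le_trans; rewrite -IE le_eqVlt; apply/orP; left; apply/eqP; congr `|_|.
rewrite (yE u) ?tu//; ring.
Qed.

(** Discrete Gronwall: a step multiplies the accumulated error by at most 1 + |b| d <= exp(|b| d)
    and adds the local error of [sde_step]. *)
Lemma euler_error (tt : nat -> R) (N : nat) (om : R) : tt 0%N = t ->
  (forall j, tt j <= tt j.+1) -> tt N <= T -> 0 <= om ->
  (forall j r, (j < N)%N -> tt j <= r <= tt j.+1 -> `|y r - y (tt j)| <= om) ->
  forall j, (j <= N)%N ->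
  `|y (tt j) - euler a b c (fun i => tt i.+1 - tt i) (fun i => w (tt i.+1) - w (tt i)) x j|
   <= `|b| * om * (tt j - t) * expR (`|b| * (tt j - t)).
Proof.
move=> tt0 ttS ttN om0 hom.
have ttm i j : (i <= j)%N -> tt i <= tt j.
  by move=> ij; elim: j ij => [|j IH]; [rewrite leqn0 => /eqP -> |
    rewrite leq_eqVlt => /predU1P[->//|]; rewrite ltnS => /IH /le_trans; apply].
have ttt j : t <= tt j by rewrite -tt0; exact: ttm.
have tT : t <= T by rewrite -tt0; apply: le_trans ttN; exact: ttm.
elim=> [_|j IH jN].
  rewrite tt0 /= (yE t) ?lexx// set_itv1 Rintegral_set1 !subrr mulr0 !addr0 subrr normr0.
  by rewrite mulr0 mul0r.
have {}IH := IH (ltnW jN).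
have jT : tt j.+1 <= T by apply: le_trans ttN; exact: ttm.
have st := sde_step (tt j) (tt j.+1) om (ttt j) (ttS j) jT (fun r => hom j r jN).
rewrite /=; set e := euler _ _ _ _ _ _ _ in IH *.
set d := tt j.+1 - tt j in st *.
have d0 : 0 <= d by rewrite subr_ge0.
have -> : y (tt j.+1) - (e + (a + b * e) * d + c * (w (tt j.+1) - w (tt j))) =
  (y (tt j.+1) - (y (tt j) + (a + b * y (tt j)) * d + c * (w (tt j.+1) - w (tt j))))
  + (1 + b * d) * (y (tt j) - e) by ring.
apply: (le_trans (ler_normD _ _)); rewrite normrM.
apply: (@le_trans _ _ (`|b| * om * d + expR (`|b| * d) *
    (`|b| * om * (tt j - t) * expR (`|b| * (tt j - t))))).
  apply: lerD => //; apply: ler_pM => //.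
  apply: le_trans (expR_ge1Dx _); apply: le_trans (ler_normD _ _) _.
  by rewrite normr1 normrM (ger0_norm d0).
have -> : tt j.+1 - t = d + (tt j - t) by rewrite /d; ring.
rewrite [`|b| * (d + _)]mulrDr expRD.
have h1 : 1 <= expR (`|b| * d) * expR (`|b| * (tt j - t)).
  by rewrite -expRD -expR0 ler_expR addr_ge0// mulr_ge0// subr_ge0.
have h2 : 0 <= `|b| * om * d by rewrite !mulr_ge0.
have := ler_wpM2l h2 h1; rewrite mulr1.
set E1 := expR _; set E2 := expR _ => h.
rewrite (_ : `|b| * om * (d + _) * (E1 * E2) = `|b| * om * d * (E1 * E2) + E1 * (`|b| * om * (tt j - t) * E2)).
  by rewrite lerD2r.
by ring.
Qed.

End euler.

Section euler_limits.
Context {R : realType}.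

Lemma euler_cvg (a b c t T x s : R) (w y : R -> R) (tt : nat -> nat -> R) (J N : nat -> nat) :
  {within `[t, T], continuous y} ->
  (forall s, t <= s <= T ->
    y s = x + Rintegral (@lebesgue_measure R) `[t, s] (fun r => a + b * y r) + c * (w s - w t)) ->
  (forall K, tt K 0%N = t) -> (forall K j, tt K j <= tt K j.+1) ->
  (forall K, tt K (N K) <= T) ->
  (forall eta, 0 < eta -> \forall K \near \oo, forall j, tt K j.+1 - tt K j < eta) ->
  (forall K, (J K <= N K)%N) -> (forall K, tt K (J K) = s) ->
  (fun K => euler a b c (fun i => tt K i.+1 - tt K i)
    (fun i => w (tt K i.+1) - w (tt K i)) x (J K)) @ \oo --> y s.
Proof.
move=> cy yE tt0 ttS ttN mesh JN ttJ.
have ttm K i j : (i <= j)%N -> tt K i <= tt K j.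
  by move=> ij; elim: j ij => [|j IH]; [rewrite leqn0 => /eqP -> |
    rewrite leq_eqVlt => /predU1P[->//|]; rewrite ltnS => /IH /le_trans; apply].
have ts : 0 <= s - t by rewrite -(ttJ 0%N) -(tt0 0%N) subr_ge0; exact: ttm.
apply/cvgrPdist_le => e e0.
pose C := `|b| * (s - t) * expR (`|b| * (s - t)).
have C0 : 0 <= C by rewrite !mulr_ge0// expR_ge0.
(* The added 1 keeps the denominator positive, since C vanishes when b = 0 or s = t. *)
pose om := e / (C + 1).
have om0 : 0 < om by rewrite divr_gt0// ltr_wpDl.
have [eta eta0 heta] := segment_uniform_continuity y t T om cy om0.
have := mesh _ eta0; apply: filterS => K hK.
rewrite -{1}(ttJ K); apply: le_trans.
  apply: (euler_error a b c t T x w y cy yE (tt K) (N K) om) => //.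
  - exact: ltW.
  - move=> j r jN /andP[jr rj]; apply/ltW/heta.
    + rewrite in_itv/=; apply/andP; split.
        by apply: le_trans jr; rewrite -(tt0 K); exact: ttm.
      by apply: le_trans rj _; apply: le_trans (ttN K); exact: ttm.
    + rewrite in_itv/=; apply/andP; split; first by rewrite -(tt0 K); exact: ttm.
      by apply: le_trans (ttN K); apply: ttm; exact: ltnW.
    + rewrite ger0_norm ?subr_ge0//; apply: le_lt_trans (hK j).
      by rewrite lerD2r.
rewrite ttJ (_ : _ * _ = om * C); last by rewrite /C; ring.
by rewrite /om mulrAC ler_pdivrMr ?ltr_wpDl// ler_pM2l// lerDl.
Qed.

(* The difference of the two schemes satisfies a linear recursion; the last
   hypothesis makes it vanish at step [L], and it stays zero afterwards. *)
Lemma euler_shift (a b c x del0 kap : R) (del dw h : nat -> R) (L : nat) :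
  (forall i, (i < L)%N -> del i = del0) ->
  (forall i, (i < L)%N -> h i = kap * del0) ->
  (forall i, (L <= i)%N -> h i = 0) ->
  (1 + b * del0) ^+ L * x = c * kap * del0 * \sum_(i < L) (1 + b * del0) ^+ i ->
  forall j, (L <= j)%N ->
  euler a b c del dw x j = euler a b c del (fun i => dw i + h i) 0 j.
Proof.
move=> hd hh h0 hx.
have key j : (j <= L)%N -> euler a b c del dw x j - euler a b c del (fun i => dw i + h i) 0 j
    = (1 + b * del0) ^+ j * x - c * kap * del0 * \sum_(i < j) (1 + b * del0) ^+ i.
  elim: j => [_|j IH jL]; first by rewrite big_ord0 expr0/=; ring.
  have := IH (ltnW jL); rewrite /= hd// hh//.
  set e1 := euler _ _ _ _ _ _ _; set e2 := euler _ _ _ _ _ _ _ => {}IH.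
  rewrite (_ : _ - _ = (1 + b * del0) * (e1 - e2) - c * kap * del0); last by ring.
  rewrite IH big_ord_recl expr0.
  rewrite (_ : \sum_(i < j) _ ^+ lift ord0 i =
    (1 + b * del0) * \sum_(i < j) (1 + b * del0) ^+ i).
    by rewrite exprS; ring.
  by rewrite mulr_sumr; apply: eq_bigr => i _; rewrite -exprS.
move=> j; elim: j => [|j IH].
  rewrite leqn0 => /eqP L0; apply/eqP; rewrite -subr_eq0; apply/eqP.
  by rewrite -{1 2}L0 key// hx subrr.
rewrite leq_eqVlt => /predU1P[Lj|].
  by apply/eqP; rewrite -subr_eq0 -Lj key// hx subrr.
by rewrite ltnS => Lj; rewrite /= IH// h0// addr0.
Qed.

(** With u = x / n, the bound 1 + z <= e^z at z = u and at z = - u / (1 + u) gives e^(u / (1 + u))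
    <= 1 + u <= e^u; n-th powers are then squeezed. *)
Lemma cvg_expR_pow (x : R) : (fun K => (1 + x / K.+1%:R) ^+ K.+1) @ \oo --> expR x.
Proof.
have hu : (fun K => x / K.+1%:R : R) @ \oo --> (0:R).
  have := @cvgMl_tmp _ _ \oo _ _ x _ (@cvg_harmonic R); rewrite mulr0; exact.
have hu1 : (fun K => 1 + x / K.+1%:R : R) @ \oo --> (1:R).
  by have := cvgD (cvg_cst (1:R)) hu; rewrite addr0; exact.
apply: (@squeeze_cvgr _ _ _ _ (fun K => expR (x / (1 + x / K.+1%:R))) (fun=> expR x)).
- have : \forall K \near \oo, `|0 - x / K.+1%:R| < (1:R).
    by move/cvgrPdist_lt : hu; apply.
  apply: filterS => K; rewrite sub0r normrN; set u := x / _ => hK.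
  have u1 : 0 < 1 + u by move: hK; rewrite ltr_norml => /andP[h _]; rewrite -ltrBlDl sub0r.
  have xE : x = K.+1%:R * u by rewrite /u mulrC divfK.
  apply/andP; split.
    rewrite [X in expR (X / _)]xE -mulrA expRM_natl lerXn2r ?nnegrE ?expR_ge0 ?(ltW u1)//.
    rewrite -[leRHS]invrK -[leLHS]invrK lef_pV2 ?posrE ?invr_gt0 ?expR_gt0// -expRN.
    apply: le_trans (expR_ge1Dx _); rewrite le_eqVlt; apply/orP; left; apply/eqP.
    by field; exact: lt0r_neq0.
  rewrite [in leRHS]xE expRM_natl lerXn2r ?nnegrE ?expR_ge0 ?(ltW u1)//.
  exact: expR_ge1Dx.
- apply: (@cvg_comp _ _ _ _ expR _ (nbhs x)); last exact: continuous_expR.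
  have := @cvgMl_tmp _ _ \oo _ _ x _ (cvgV (oner_neq0 R) hu1); rewrite invr1 mulr1; exact.
- exact: cvg_cst.
Qed.

(* Solves the last hypothesis of [euler_shift] for [kap / x] with [L = K.+1]
   steps of size [tau / L]. *)
Definition shift_rate (b c tau : R) (K : nat) : R :=
  (1 + b * (tau / K.+1%:R)) ^+ K.+1 /
  (c * (tau / K.+1%:R) * \sum_(i < K.+1) (1 + b * (tau / K.+1%:R)) ^+ i).

(** Once |b tau / (K+1)| < 1, every term of the geometric sum is positive, so the denominator of
    [shift_rate] is nonzero. *)
Lemma shift_rate_spec (b c tau x : R) : c != 0 -> 0 < tau -> \forall K \near \oo,
  (1 + b * (tau / K.+1%:R)) ^+ K.+1 * x =
  c * (x * shift_rate b c tau K) * (tau / K.+1%:R) *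
    \sum_(i < K.+1) (1 + b * (tau / K.+1%:R)) ^+ i.
Proof.
move=> c0 tau0.
have hu : (fun K => b * (tau / K.+1%:R) : R) @ \oo --> (0:R).
  rewrite (_ : (fun K => _) = fun K => b * tau * (@harmonic R K)).
    by have := @cvgMl_tmp _ _ \oo _ _ (b * tau) _ (@cvg_harmonic R); rewrite mulr0; exact.
  by apply/funext => K; rewrite /harmonic/= mulrA.
have : \forall K \near \oo, `|0 - b * (tau / K.+1%:R)| < (1:R).
  by move/cvgrPdist_lt : hu; apply.
apply: filterS => K; rewrite sub0r normrN /shift_rate; set u := b * _ => hK.
have u1 : 0 < 1 + u by move: hK; rewrite ltr_norml => /andP[h _]; rewrite -ltrBlDl sub0r.
have S0 : \sum_(i < K.+1) (1 + u) ^+ i != 0.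
  rewrite gt_eqF// big_ord_recl/= expr0 ltr_pwDl// sumr_ge0// => i _.
  by rewrite exprn_ge0// ltW.
set S := \sum_(i < _) _ in S0 *.
by field; rewrite S0 c0 (lt0r_neq0 tau0)/= andbT nat1r pnatr_eq0.
Qed.

Lemma shift_rate_cvg (b c tau : R) : c != 0 -> 0 < tau ->
  cvgn (shift_rate b c tau).
Proof.
move=> c0 tau0; have [->|b0] := eqVneq b 0.
  apply: (is_cvg_near_cst (c * tau)^-1); exists 0%N => // K _.
  rewrite /shift_rate/= mul0r addr0 expr1n mul1r.
  under eq_bigr do rewrite expr1n.
  by rewrite sumr_const card_ord; congr (_^-1); field; rewrite nat1r pnatr_eq0.
have h := cvg_expR_pow (b * tau).
have e1 : expR (b * tau) - 1 != 0.
  by rewrite subr_eq0 -expR0 (inj_eq (@expR_inj R)) mulf_neq0// gt_eqF.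
apply/cvg_ex; exists (b * expR (b * tau) / (c * (expR (b * tau) - 1))).
(* For b <> 0 the geometric sum is ((1 + u)^(K+1) - 1) / u with u = b tau / (K+1), which leaves only
   powers converging to e^{b tau}. *)
rewrite (_ : shift_rate b c tau = (fun K => b * (1 + (b * tau) / K.+1%:R) ^+ K.+1 /
    (c * ((1 + (b * tau) / K.+1%:R) ^+ K.+1 - 1)))).
  apply: cvgM; first exact: cvgMl_tmp.
  apply: cvgV; first by rewrite mulf_neq0.
  by apply: cvgMl_tmp; apply: cvgB => //; exact: cvg_cst.
apply/funext => K; rewrite /shift_rate -[b * tau / _]mulrA subrX1.
set z := 1 + _; set S := \sum_(i < _) _.
have d0 : b * (tau / K.+1%:R) != 0 by rewrite !mulf_neq0 ?invr_neq0 ?pnatr_eq0// gt_eqF.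
have -> : z - 1 = b * (tau / K.+1%:R) by rewrite /z; ring.
(* If the geometric sum vanishes, both quotients have a zero denominator and equal 0 by convention,
   so the identity holds for every K. *)
have [->|S0] := eqVneq S 0; first by rewrite !mulr0 !invr0 !mulr0.
by field; rewrite nat1r pnatr_eq0 S0 c0 b0 (lt0r_neq0 tau0).
Qed.

End euler_limits.

(** * Expectations of functionals of the Ornstein-Uhlenbeck process *)

Section gaussian_exponential_moments.
Context {R : realType} {d} {Om : measurableType d} (P : probability Om R).
Variables (X : Om -> R) (v : R).
Hypotheses (v0 : 0 < v) (mX : measurable_fun setT X).
Hypothesis lawX : forall B, measurable B -> P (X @^-1` B) = normal_prob 0 (Num.sqrt v) B.

Lemma integrable_expR_gaussian k : P.-integrable setT (fun w => (expR (k * X w))%:E).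
Proof.
have mk (h : R -> R) : measurable_fun setT h -> measurable_fun setT (fun w => expR (h (X w))).
  by move=> mh; apply: measurableT_comp => //; exact: measurableT_comp.
apply/integrableP; split; first by apply/measurable_EFinP; apply: (mk (fun y => k * y)); exact: measurable_funM.
under eq_integral do rewrite /= ger0_norm ?expR_ge0//.
rewrite (_ : (fun w => _) = fun w =>
    ((expR (k ^+ 2 * v / 2))%:E * (expR (k * X w - k ^+ 2 * v / 2))%:E)%E); last first.
  by apply/funext => w; rewrite -EFinM -expRD addrC subrK.
rewrite ge0_integralZl//.
(* Tilting over the whole space gives total mass 1, so the exponential moment is exp(k^2 v / 2). *)
- have := gaussian_tilt _ _ P X v k v0 mX lawX setT measurableT.
  rewrite preimage_setT => ->.
  rewrite preimage_setT; apply: lte_mul_pinfty; rewrite ?lee_fin ?expR_ge0//.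
  by rewrite (le_lt_trans (probability_le1 P measurableT)) ?ltry.
- apply/measurable_EFinP; apply: (mk (fun y => k * y - k ^+ 2 * v / 2)).
  by apply: measurable_funB => //; exact: measurable_funM.
Qed.

Lemma integrable_expR_abs_gaussian k : P.-integrable setT (fun w => (expR (k * `|X w|))%:E).
Proof.
have mk : measurable_fun setT (fun w => expR (k * `|X w|)).
  apply: measurableT_comp => //; apply: measurable_funM => //.
  exact: measurableT_comp.
apply: (@le_integrable _ _ _ P setT measurableT _
  (fun w => (expR (k * X w))%:E + (expR (- k * X w))%:E)%E).
- exact/measurable_EFinP.
- move=> w _ /=; rewrite lee_fin (ger0_norm (expR_ge0 _)).
  rewrite [leRHS]ger0_norm ?addr_ge0 ?expR_ge0//.
  have [X0|X0] := ger0P (X w); first by rewrite lerDl expR_ge0.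
  by rewrite mulrN -mulNr lerDr expR_ge0.
- by apply: integrableD => //; exact: integrable_expR_gaussian.
Qed.

End gaussian_exponential_moments.

(** The exponential series is integrated term by term, with coefficients E[H X^k] / k!; since |H| <=
    1, all its partial sums are dominated by exp(|x| |X|), which is integrable. *)
Lemma entire_exp_moment {R : realType} d (Om : measurableType d) (P : probability Om R)
  (X H : Om -> R) (v : R) : 0 < v -> measurable_fun setT X ->
  (forall B, measurable B -> P (X @^-1` B) = normal_prob 0 (Num.sqrt v) B) ->
  measurable_fun setT H -> (forall w, `|H w| <= 1) ->
  entire (fun k => Rintegral P setT (fun w => H w * expR (k * X w))).
Proof.
move=> v0 mX lawX mH H1.
pose c k w := H w * (k`!%:R^-1 * X w ^+ k).
have mc k : measurable_fun setT (c k).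
  by apply: measurable_funM => //; apply: measurable_funM => //; exact: measurable_funX.
have series_le x w N : series (fun k => `|k`!%:R^-1 * (x * X w) ^+ k|) N <= expR (`|x| * `|X w|).
  rewrite /expR exp_coeffE.
  apply: le_trans (nondecreasing_cvgn_le _ _ N); last 2 first.
  - apply: nondecreasing_series => k _ _.
    by rewrite mulr_ge0 ?invr_ge0// exprn_ge0// mulr_ge0.
  - by rewrite -exp_coeffE; exact: is_cvg_series_exp_coeff.
  rewrite le_eqVlt /series/=; apply/orP; left; apply/eqP; apply: eq_bigr => k _.
  by rewrite normrM normrX normrM ger0_norm// invr_ge0.
have ic k : P.-integrable setT (EFin \o c k).
  apply: (@le_integrable _ _ _ P setT measurableT _ (fun w => (expR (1 * `|X w|))%:E)).
  - exact/measurable_EFinP.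
  - move=> w _ /=; rewrite lee_fin (ger0_norm (expR_ge0 _)).
    rewrite normrM; apply: le_trans (ler_piMl _ (H1 w)) _ => //.
    have := series_le 1 w k.+1; rewrite normr1; apply: le_trans.
    by rewrite /series/= big_nat_recr//= mul1r lerDr sumr_ge0.
  - exact: (integrable_expR_abs_gaussian P X v).
exists (fun k => Rintegral P setT (c k)) => x.
rewrite (_ : series _ = (fun N => fine (\int[P]_w (series (fun k => x ^+ k * c k w) N)%:E)%E)); last first.
  apply/funext => N; rewrite /series/=.
  transitivity (fine (\sum_(0 <= k < N) \int[P]_w ((x ^+ k)%:E * (c k w)%:E))%E).
    rewrite -sum_fine => [|k _]; last first.
      by apply: integrable_fin_num => //; apply: integrableZl => //; exact: ic.
    apply: eq_bigr => k _; rewrite integralZl//; last exact: ic.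
    have ik := integrable_fin_num measurableT (ic k).
    by rewrite (fineM _ ik)// mulrC.
  rewrite -integral_sum//; last by move=> k; apply: integrableZl => //; exact: ic.
  by congr fine; apply: eq_integral => w _; rewrite -sumEFin.
rewrite /Rintegral.
have mE k : measurable_fun setT (fun w => H w * expR (k * X w)).
  by apply: measurable_funM => //; apply: measurableT_comp => //; exact: measurable_funM.
have dom w N : `|series (fun k => x ^+ k * c k w) N| <= expR (`|x| * `|X w|).
  apply: le_trans (series_le x w N); apply: le_trans (ler_norm_sum _ _ _) _.
  apply: ler_sum => k _; rewrite /c exprMn.
  rewrite (_ : x ^+ k * _ = H w * (k`!%:R^-1 * (x ^+ k * X w ^+ k))); last by ring.
  by rewrite normrM ler_piMl.
have ig := integrable_expR_abs_gaussian P X v v0 mX lawX `|x|.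
have lim w : series (fun k => x ^+ k * c k w) @ \oo --> H w * expR (x * X w).
  rewrite (_ : series _ = (fun N => H w * series (fun k => k`!%:R^-1 * (x * X w) ^+ k) N)).
    apply: cvgMl_tmp; rewrite -exp_coeffE /expR; exact: is_cvg_series_exp_coeff.
  apply/funext => N; rewrite /series/= mulr_sumr; apply: eq_bigr => k _.
  by rewrite /c exprMn; ring.
apply: fine_cvg; rewrite fineK; last first.
  apply: integrable_fin_num => //.
  apply: le_integrable ig => //; first exact/measurable_EFinP.
  move=> w _ /=; rewrite lee_fin (ger0_norm (expR_ge0 _)).
  rewrite normrM; apply: le_trans (ler_piMl _ (H1 w)) _ => //.
  by rewrite (ger0_norm (expR_ge0 _)) ler_expR -normrM ler_norm.
apply: (@dominated_cvg _ _ _ P setT measurableT _ _ (fun w => (expR (`|x| * `|X w|))%:E)) => //.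
- move=> N; apply/measurable_EFinP; apply: measurable_sum => k.
  by apply: measurable_funM => //; exact: mc.
- move=> w _; apply: cvg_EFin; last exact: lim.
  by apply: nearW.
- by move=> N w _ /=; rewrite lee_fin.
Qed.

Section mesh.
Context {R : realType}.
Variables (t tau Dl : R).
Hypotheses (tau0 : 0 < tau) (Dl0 : 0 < Dl).

(* [K.+1] steps on [[t, t + tau]], then [K.+1] steps on each further interval of length [Dl]. *)
Definition mesh (K j : nat) : R :=
  t + (minn j K.+1)%:R * (tau / K.+1%:R) + (j - K.+1)%:R * (Dl / K.+1%:R).

Lemma mesh0 K : mesh K 0 = t.
Proof. by rewrite /mesh min0n sub0n !mul0r !addr0. Qed.

Lemma mesh_step_first K i : (i < K.+1)%N -> mesh K i.+1 - mesh K i = tau / K.+1%:R.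
Proof.
move=> iK; rewrite /mesh !(minn_idPl _)// 1?ltnW//.
rewrite (eqP (_ : i.+1 - K.+1 == 0)%N) ?subn_eq0// (eqP (_ : i - K.+1 == 0)%N) ?subn_eq0 1?ltnW//.
by rewrite -natr1; ring.
Qed.

Lemma mesh_step_next K i : (K.+1 <= i)%N -> mesh K i.+1 - mesh K i = Dl / K.+1%:R.
Proof.
move=> Ki; rewrite /mesh !(minn_idPr _)// 1?leqW// subSn// -natr1; ring.
Qed.

Lemma mesh_lt K i : mesh K i < mesh K i.+1.
Proof.
rewrite -subr_gt0; have [iK|Ki] := ltnP i K.+1.
  by rewrite mesh_step_first// divr_gt0.
by rewrite mesh_step_next// divr_gt0.
Qed.

Lemma mesh_point K m : mesh K (K.+1 * m.+1)%N = t + tau + m%:R * Dl.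
Proof.
rewrite /mesh (minn_idPr _) ?leq_pmulr// mulnS addKn natrM.
by field; rewrite nat1r pnatr_eq0.
Qed.

Lemma mesh_fine eta : 0 < eta -> \forall K \near \oo, forall j, mesh K j.+1 - mesh K j < eta.
Proof.
move=> eta0.
have h (x : R) : \forall K \near \oo, x / K.+1%:R < eta.
  have hx : (fun K => x / K.+1%:R : R) @ \oo --> (0:R).
    by have := @cvgMl_tmp _ _ \oo _ _ x _ (@cvg_harmonic R); rewrite mulr0; exact.
  move/cvgrPdist_lt : hx => /(_ _ eta0); apply: filterS => K.
  by rewrite sub0r normrN; apply: le_lt_trans; exact: ler_norm.
near=> K => j; have [jK|Kj] := ltnP j K.+1.
  by rewrite mesh_step_first//; near: K; exact: h.
by rewrite mesh_step_next//; near: K; exact: h.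
Unshelve. all: by end_near. Qed.

End mesh.

(** * The shift formula and its passage to the limit *)

Section ou_shift.
Context {R : realType} {d : measure_display} {Om : measurableType d}.
Variables (P : probability Om R) (W : R -> Om -> R) (a b c t tau Dl T : R) (M : nat).
Variable (Y : R -> R -> Om -> R).
Hypotheses (bm : brownian_motion P W) (c0 : c != 0) (t0 : 0 <= t)
  (tau0 : 0 < tau) (Dl0 : 0 < Dl) (TE : T = t + tau + M%:R * Dl).
Hypothesis solY : forall x, ou_solution_from W a b c T t x (Y x).

Let tt := mesh t tau Dl.
Let D K i w := W (tt K i.+1) w - W (tt K i) w.
Let v K i := tt K i.+1 - tt K i.

(** The scheme sampled at t + tau + m Dl, the only times that the functional [G] reads. *)
Let eul (x : R) K (dw : nat -> R) : nat -> R :=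
  fun m => euler a b c (v K) dw x (K.+1 * m.+1)%N.

Local Notation pt m := (t + tau + m%:R * Dl).

Let tt_ge0 K i : 0 <= tt K i.
Proof.
elim: i => [|i /le_trans]; first by rewrite /tt mesh0.
by apply; apply/ltW/mesh_lt.
Qed.

Let mD K i : measurable_fun setT (D K i).
Proof. by case: bm => mW _ _ _ _; apply: measurable_funB; exact: mW. Qed.

Let v0 K i : 0 < v K i.
Proof. by rewrite subr_gt0; exact: mesh_lt. Qed.

Let lawD K i B : measurable B -> P (D K i @^-1` B) = normal_prob 0 (Num.sqrt (v K i)) B.
Proof. by case: bm => _ _ _ law _ mB; apply: law => //; exact: mesh_lt. Qed.

Let indepD K k (B : nat -> set R) : (forall i, measurable (B i)) ->
  P (\bigcap_(i in [set i | (i < k)%N]) (D K i @^-1` B i)) =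
  \big[*%E/1%E]_(i < k) P (D K i @^-1` B i).
Proof. by case: bm => _ _ _ _ ind mB; apply: ind => // i _; exact: mesh_lt. Qed.

Let euler_measurable d' (S : measurableType d') (dw : nat -> S -> R) K x j :
  (forall i, measurable_fun setT (dw i)) ->
  measurable_fun setT (fun w => euler a b c (v K) (dw ^~ w) x j).
Proof.
move=> mdw; elim: j => [|j IH] //=.
apply: measurable_funD; last exact: measurable_funM.
by apply: measurable_funD => //; apply: measurable_funM => //; apply: measurable_funD => //; exact: measurable_funM.
Qed.

Lemma eul_cvg x w m : (m <= M)%N -> (fun K => eul x K (D K ^~ w) m) @ \oo --> Y x (pt m) w.
Proof.
move=> mM; have [cY YE] := solY x w.
apply: (euler_cvg a b c t T x (pt m) (W ^~ w) (Y x ^~ w) tt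
  (fun K => K.+1 * m.+1)%N (fun K => K.+1 * M.+1)%N) => //.
- by move=> K; rewrite /tt mesh0.
- by move=> K j; apply/ltW/mesh_lt.
- by move=> K; rewrite /tt mesh_point TE.
- by move=> eta eta0; apply: mesh_fine.
- by move=> K; rewrite leq_mul2l /= ltnS.
- by move=> K; rewrite /tt mesh_point.
Qed.

Definition incr w := W (t + tau) w - W t w.

Lemma measurable_incr : measurable_fun setT incr.
Proof.
case: bm => mW _ _ _ _; apply: measurable_funB; apply: mW => //.
by rewrite addr_ge0// ltW.
Qed.

Lemma law_incr B : measurable B -> P (incr @^-1` B) = normal_prob 0 (Num.sqrt tau) B.
Proof.
case: bm => _ _ _ law _ mB; rewrite (law t (t + tau)) ?ltrDl//.
by rewrite addrAC subrr add0r.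
Qed.

Variable G : g_sigma_algebraType (@cylinder R) -> R.
Hypotheses (mG : measurable_fun setT G) (G1 : forall f, `|G f| <= 1).
(** Only coordinates up to M are required to converge: later sampling times exceed T, where [Y] is
    not constrained. *)
Hypothesis cG : forall (f : nat -> nat -> R) (g : nat -> R),
  (forall m, (m <= M)%N -> (fun K => f K m) @ \oo --> g m) -> (fun K => G (f K)) @ \oo --> G g.

Let meul x K : measurable_fun setT (fun f : g_sigma_algebraType (@cylinder R) =>
  (eul x K f : g_sigma_algebraType (@cylinder R))).
Proof.
apply: (@measurable_to_cylinder R _ (g_sigma_algebraType (@cylinder R)) (fun m f => eul x K f m)) => m.
by apply: (@euler_measurable _ _ (fun i (f : g_sigma_algebraType (@cylinder R)) => f i));
  exact: measurable_coord.
Qed.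

Let mGeul x K : measurable_fun setT (fun w => G (eul x K (D K ^~ w))).
Proof.
have := measurableT_comp mG (measurableT_comp (meul x K) (measurable_to_cylinder _ _ (D K) (mD K))).
exact.
Qed.

(** Measurability is inherited from the Euler schemes, which are measurable in the Brownian
    increments, by pointwise convergence. *)
Let mGY x : measurable_fun setT (fun w => G (fun m => Y x (pt m) w)).
Proof.
apply: (measurable_fun_cvg (mGeul x)) => w _; apply: cG => m mM; exact: eul_cvg.
Qed.

Lemma measurable_ou x : measurable_fun setT (fun w => G (fun m => Y x (pt m) w)).
Proof. exact: mGY. Qed.

(** Only the first K+1 increments are shifted, all at the same rate k, so the product of their tilts
    telescopes to a function of the single variable [incr]. *)
Lemma ou_shift_discrete x : \forall K \near \oo,
  (\int[P]_w (G (eul x K (D K ^~ w)))%:E =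
   \int[P]_w (G (eul 0 K (D K ^~ w)) * expR (x * shift_rate b c tau K * incr w -
      (x * shift_rate b c tau K) ^+ 2 * tau / 2))%:E)%E.
Proof.
have := shift_rate_spec b c tau x c0 tau0; apply: filterS => K hK.
set k := x * _ in hK *.
pose kap i := if (i < K.+1)%N then k else 0.
have E := @gaussian_vector_shift R d Om P (D K) (v K) kap (mD K) (v0 K) (lawD K) (indepD K) K.+1.
transitivity (\int[P]_w (G (eul 0 K (fun i => D K i w + kap i * v K i)))%:E)%E.
  apply: eq_integral => w _; congr (G _)%:E; apply/funext => m; rewrite /eul.
  apply: (@euler_shift R a b c x (tau / K.+1%:R) k (v K) _ (fun i => kap i * v K i) K.+1) => //.
  - by move=> i iK; rewrite /v /tt mesh_step_first.
  - by move=> i iK; rewrite /v /tt mesh_step_first// /kap iK.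
  - by move=> i iK; rewrite /kap ltnNge iK mul0r.
  - exact: leq_pmulr.
rewrite (E _ (G \o eul 0 K)).
- apply: eq_integral => w _; congr (_ * _)%:E; rewrite -expR_sum; congr expR.
  rewrite sumrB; congr (_ - _).
    rewrite (eq_bigr (fun i : 'I_K.+1 => k * D K i w)); last by move=> i _; rewrite /kap ltn_ord.
    rewrite -mulr_sumr; congr (_ * _).
    rewrite -(big_mkord xpredT (fun i => D K i w)) telescope_sumr// /tt mesh0.
    by have := mesh_point t tau Dl K 0; rewrite muln1 mul0r addr0 => ->.
  rewrite (eq_bigr (fun i : 'I_K.+1 => k ^+ 2 / 2 * v K i)); last first.
    by move=> i _; rewrite /kap ltn_ord; ring.
  rewrite -mulr_sumr -(big_mkord xpredT (v K)) telescope_sumr// /tt mesh0.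
  have := mesh_point t tau Dl K 0; rewrite muln1 mul0r addr0 => ->.
  by ring.
- by move=> i Ki; rewrite /kap ltnNge Ki.
- exact: (measurableT_comp mG (meul 0 K)).
Qed.

Lemma ou_shift x : let k := x * limn (shift_rate b c tau) in
  Rintegral P setT (fun w => G (fun m => Y x (pt m) w)) =
  expR (- (k ^+ 2 * tau / 2)) *
  Rintegral P setT (fun w => G (fun m => Y 0 (pt m) w) * expR (k * incr w)).
Proof.
move=> k.
pose kK K := x * shift_rate b c tau K.
have kKk : kK @ \oo --> k by apply: cvgMl_tmp; exact: shift_rate_cvg.
(* The rates vary with K; a common bound B yields the single dominating function exp(B |incr|). *)
have [C [Cr hC]] : bounded_fun kK by apply: cvg_seq_bounded; apply/cvg_ex; exists k.
pose B := `|C| + 1.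
have kB K : `|kK K| <= B.
  by apply: hC => //; rewrite (le_lt_trans (ler_norm C))// ltrDl.
have dom1 : P.-integrable setT (fun w => (1%R : R)%:E).
  apply/integrableP; split; first exact/measurable_EFinP.
  under eq_integral do rewrite /= normr1.
  by rewrite integral_cst// mul1e (le_lt_trans (probability_le1 P measurableT)) ?ltry.
have lhs : (fun K => \int[P]_w (G (eul x K (D K ^~ w)))%:E)%E @ \oo -->
    (\int[P]_w (G (fun m => Y x (pt m) w))%:E)%E.
  apply: (@dominated_cvg _ _ _ P setT measurableT _ _ (fun w => (1%R : R)%:E)) => //.
  - by move=> K; apply/measurable_EFinP.
  - move=> w _; apply: cvg_EFin; first exact: nearW.
    by apply: cG => m mM; exact: eul_cvg.
  - by move=> K w _ /=; rewrite lee_fin.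
have mexp z : measurable_fun setT (fun w => expR (z * incr w - z ^+ 2 * tau / 2)).
  apply: measurableT_comp => //; apply: measurable_funB => //.
  by apply: measurable_funM => //; exact: measurable_incr.
have igB := integrable_expR_abs_gaussian P incr tau tau0 measurable_incr law_incr B.
have rhs : (fun K => \int[P]_w (G (eul 0 K (D K ^~ w)) *
      expR (kK K * incr w - kK K ^+ 2 * tau / 2))%:E)%E @ \oo -->
    (\int[P]_w (G (fun m => Y 0 (pt m) w) * expR (k * incr w - k ^+ 2 * tau / 2))%:E)%E.
  apply: (@dominated_cvg _ _ _ P setT measurableT _ _ (fun w => (expR (B * `|incr w|))%:E)) => //.
  - by move=> K; apply/measurable_EFinP; exact: (measurable_funM (mGeul 0 K) (mexp (kK K))).
  - move=> w _; apply: cvg_EFin; first exact: nearW.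
    apply: cvgM; first by apply: cG => m mM; exact: eul_cvg.
    apply: (@cvg_comp _ _ _ _ expR _ (nbhs (k * incr w - k ^+ 2 * tau / 2))); last exact: continuous_expR.
    apply: cvgB; first exact: cvgMr_tmp.
    do 2 apply: cvgMr_tmp; exact: cvgM.
  - move=> K w _ /=; rewrite lee_fin normrM (ger0_norm (expR_ge0 _)).
    apply: le_trans (ler_piMl (expR_ge0 _) (G1 _)) _; rewrite ler_expR.
    apply: (@le_trans _ _ (kK K * incr w)).
      by rewrite gerBl divr_ge0// mulr_ge0 ?sqr_ge0// ltW.
    by apply: le_trans (ler_norm _) _; rewrite normrM ler_wpM2r.
have -> : Rintegral P setT (fun w => G (fun m => Y x (pt m) w)) =
    Rintegral P setT (fun w => G (fun m => Y 0 (pt m) w) * expR (k * incr w - k ^+ 2 * tau / 2)).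
  rewrite /Rintegral -(cvg_lim _ lhs)// -(cvg_lim _ rhs)//.
  (* The discrete formula holds only for large K, which is enough for the two limits to coincide. *)
  congr (fine (lim _)); apply/seteqP; split; apply: near_eq_cvg; near=> K.
    by near: K; exact: (ou_shift_discrete x).
  by apply/esym; near: K; exact: (ou_shift_discrete x).
rewrite -RintegralZl//; first by apply: eq_Rintegral => w _; rewrite expRD; ring.
apply: le_integrable (integrable_expR_abs_gaussian P incr tau tau0 measurable_incr law_incr `|k|) => //.
  apply/measurable_EFinP; apply: measurable_funM; first exact: mGY.
  by apply: measurableT_comp => //; apply: measurable_funM => //; exact: measurable_incr.
move=> w _ /=; rewrite lee_fin normrM !(ger0_norm (expR_ge0 _)).
by apply: le_trans (ler_piMl (expR_ge0 _) (G1 _)) _; rewrite ler_expR -normrM ler_norm.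
Unshelve. all: by end_near. Qed.

Lemma entire_ou_expectation :
  entire (fun x => Rintegral P setT (fun w => G (fun m => Y x (pt m) w))).
Proof.
have ek : entire (fun x : R => x * limn (shift_rate b c tau)).
  by apply: entireM; [exact: entire_id | exact: entire_cst].
have eH := entire_exp_moment _ _ P incr (fun w => G (fun m => Y 0 (pt m) w)) tau tau0
  measurable_incr law_incr (measurable_ou 0) (fun w => G1 _).
have eg : entire (fun x : R => expR (- ((x * limn (shift_rate b c tau)) ^+ 2 * tau / 2))).
  apply: (entire_comp _ _ entire_expR); apply: entireN.
  do 2 (apply: entireM; last exact: entire_cst).
  exact: (entireM _ _ ek ek).
have [al hal] := entireM _ _ eg (entire_comp _ _ eH ek).
by exists al => x; rewrite ou_shift; exact: hal.
Qed.

End ou_shift.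

(** * Complex exponentials *)

Section complex_parts.
Context {R : realType}.
Implicit Types (z w : R[i]).

Lemma Re_cD z w : Re_c (z + w) = Re_c z + Re_c w.
Proof. by case: z w => [? ?] [? ?]. Qed.

Lemma Im_cD z w : Im_c (z + w) = Im_c z + Im_c w.
Proof. by case: z w => [? ?] [? ?]. Qed.

Lemma Re_cM z w : Re_c (z * w) = Re_c z * Re_c w - Im_c z * Im_c w.
Proof. by case: z w => [? ?] [? ?]. Qed.

Lemma Im_cM z w : Im_c (z * w) = Re_c z * Im_c w + Im_c z * Re_c w.
Proof. by case: z w => [? ?] [? ?]. Qed.

Lemma Re_c_sum (I : Type) (r : seq I) (Q : pred I) (F : I -> R[i]) :
  Re_c (\sum_(i <- r | Q i) F i) = \sum_(i <- r | Q i) Re_c (F i).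
Proof. by elim/big_ind2 : _ => // z1 x1 z2 x2 <- <-; rewrite Re_cD. Qed.

Lemma Im_c_sum (I : Type) (r : seq I) (Q : pred I) (F : I -> R[i]) :
  Im_c (\sum_(i <- r | Q i) F i) = \sum_(i <- r | Q i) Im_c (F i).
Proof. by elim/big_ind2 : _ => // z1 x1 z2 x2 <- <-; rewrite Im_cD. Qed.

Lemma RtoCX (x : R) k : RtoC x ^+ k = RtoC (x ^+ k).
Proof.
elim: k => [|k IH]; first by rewrite !expr0.
rewrite !exprS IH; apply/eqP; rewrite eq_complex/=.
by rewrite !(mulr0, mul0r, subr0, addr0) !eqxx.
Qed.

Lemma Re_cexp z : Re_c (cexp z) = expR (Re_c z) * cos (Im_c z).
Proof. by case: z => x y; rewrite /cexp /= mul0r subr0. Qed.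

Lemma Im_cexp z : Im_c (cexp z) = expR (Re_c z) * sin (Im_c z).
Proof. by case: z => x y; rewrite /cexp /= mul0r addr0. Qed.

Lemma complex_partsP z w : Re_c z = Re_c w -> Im_c z = Im_c w -> z = w.
Proof. by case: z w => [? ?] [? ?] /= -> ->. Qed.

Lemma cexpD z w : cexp (z + w) = cexp z * cexp w.
Proof.
apply: complex_partsP.
  by rewrite Re_cM !Re_cexp !Im_cexp Re_cD Im_cD expRD cosD; ring.
by rewrite Im_cM !Re_cexp !Im_cexp Re_cD Im_cD expRD sinD; ring.
Qed.

Lemma norm_Re_cexp_le1 z : Re_c z <= 0 -> `|Re_c (cexp z)| <= 1.
Proof.
move=> z0; rewrite Re_cexp normrM (ger0_norm (expR_ge0 _)) -[1]mulr1.
apply: ler_pM; rewrite ?expR_ge0 ?expR_le1//.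
by rewrite ler_norml cos_geN1 cos_le1.
Qed.

Lemma norm_Im_cexp_le1 z : Re_c z <= 0 -> `|Im_c (cexp z)| <= 1.
Proof.
move=> z0; rewrite Im_cexp normrM (ger0_norm (expR_ge0 _)) -[1]mulr1.
apply: ler_pM; rewrite ?expR_ge0 ?expR_le1//.
by rewrite ler_norml sin_geN1 sin_le1.
Qed.

End complex_parts.

Section complex_entire.
Context {R : realType}.
Implicit Types F G : R -> R[i].

(** The variable is real, so a power series with complex coefficients is a pair of real power
    series. *)
Definition centire F := entire (fun x => Re_c (F x)) /\ entire (fun x => Im_c (F x)).

Lemma centire_ext F G : F =1 G -> centire F -> centire G.
Proof. by move=> /funext ->. Qed.

Lemma centire_cst (z : R[i]) : centire (fun=> z).
Proof. by split; exact: entire_cst. Qed.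

Lemma centire_RtoC (g : R -> R) : entire g -> centire (fun x => RtoC (g x)).
Proof. by split => //=; exact: entire_cst. Qed.

Lemma centireD F G : centire F -> centire G -> centire (fun x => F x + G x).
Proof.
move=> [Fr Fi] [Gr Gi]; split.
  by under [X in entire X]funext do rewrite Re_cD; exact: entireD.
by under [X in entire X]funext do rewrite Im_cD; exact: entireD.
Qed.

Lemma centireM F G : centire F -> centire G -> centire (fun x => F x * G x).
Proof.
move=> [Fr Fi] [Gr Gi]; split.
  under [X in entire X]funext do rewrite Re_cM.
  by apply: entireD; [|apply: entireN]; exact: entireM.
under [X in entire X]funext do rewrite Im_cM.
by apply: entireD; exact: entireM.
Qed.

Lemma centire_sum (I : Type) (r : seq I) (Q : pred I) (F : I -> R -> R[i]) :
  (forall i, Q i -> centire (F i)) -> centire (fun x => \sum_(i <- r | Q i) F i x).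
Proof.
move=> cF; split.
  under [X in entire X]funext do rewrite Re_c_sum.
  by apply: entire_sum => i /cF[].
under [X in entire X]funext do rewrite Im_c_sum.
by apply: entire_sum => i /cF[].
Qed.

Lemma centire_cexp F : centire F -> centire (fun x => cexp (F x)).
Proof.
move=> [Fr Fi]; split.
  under [X in entire X]funext do rewrite Re_cexp.
  apply: entireM; first exact: (entire_comp _ _ entire_expR Fr).
  exact: (entire_comp _ _ entire_cos Fi).
under [X in entire X]funext do rewrite Im_cexp.
apply: entireM; first exact: (entire_comp _ _ entire_expR Fr).
exact: (entire_comp _ _ entire_sin Fi).
Qed.

Lemma centire_coef F : centire F -> exists coef : nat -> R[i], forall x : R,
  ccvg (fun N => \sum_(k < N) coef k * RtoC x ^+ k) (F x).
Proof.
move=> [[al hal] [be hbe]]; exists (fun k => (al k +i* be k)%C) => x; split.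
  rewrite (_ : (fun N => _) = series (fun k => al k * x ^+ k)); first exact: hal.
  apply/funext => N; rewrite Re_c_sum /series/= big_mkord; apply: eq_bigr => k _.
  by rewrite Re_cM RtoCX/= mulr0 subr0.
rewrite (_ : (fun N => _) = series (fun k => be k * x ^+ k)); first exact: hbe.
apply/funext => N; rewrite Im_c_sum /series/= big_mkord; apply: eq_bigr => k _.
by rewrite Im_cM RtoCX/= mulr0 add0r.
Qed.

End complex_entire.

(** * Measurable functionals continuous in finitely many coordinates *)

Section cylinder_functionals.
Context {R : realType} (M : nat).
Local Notation S := (g_sigma_algebraType (@cylinder R)).

(** The two regularity properties demanded of [G] by the shift formula; continuity is sequential
    because it is applied along the Euler schemes. *)
Definition cyl_cont (F : S -> R) := measurable_fun setT F /\
  forall (f : nat -> nat -> R) (g : nat -> R),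
  (forall m, (m <= M)%N -> (fun K => f K m) @ \oo --> g m) -> (fun K => F (f K)) @ \oo --> F g.

Definition ccyl_cont (F : S -> R[i]) :=
  cyl_cont (fun f => Re_c (F f)) /\ cyl_cont (fun f => Im_c (F f)).

Lemma cyl_cont_cst (z : R) : cyl_cont (fun=> z).
Proof. by split => // f g _; exact: cvg_cst. Qed.

Lemma cyl_contD (F G : S -> R) : cyl_cont F -> cyl_cont G -> cyl_cont (fun f => F f + G f).
Proof.
move=> [mF cF] [mG cG]; split; first exact: measurable_funD.
by move=> f g fg; apply: cvgD; [exact: cF | exact: cG].
Qed.

Lemma cyl_contM (F G : S -> R) : cyl_cont F -> cyl_cont G -> cyl_cont (fun f => F f * G f).
Proof.
move=> [mF cF] [mG cG]; split; first exact: measurable_funM.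
by move=> f g fg; apply: cvgM; [exact: cF | exact: cG].
Qed.

Lemma cyl_cont_comp (h : R -> R) (F : S -> R) : continuous h -> cyl_cont F ->
  cyl_cont (fun f => h (F f)).
Proof.
move=> ch [mF cF]; split.
  by apply: (measurableT_comp _ mF); exact: continuous_measurable_fun.
move=> f g fg; apply: (@cvg_comp _ _ _ _ h _ (nbhs (F g))); first exact: cF.
exact: ch.
Qed.

Lemma cyl_cont_power_sum (al : nat -> R) (h : R -> R) m : (m <= M)%N -> power_sum al h ->
  cyl_cont (fun f => h (f m)).
Proof.
move=> mM hal; split.
  apply: (measurableT_comp (power_sum_measurable hal)); exact: measurable_coord.
by move=> f g fg; apply: (power_sum_cvg hal); exact: fg.
Qed.

Lemma ccyl_cont_cst (z : R[i]) : ccyl_cont (fun=> z).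
Proof. by split; exact: cyl_cont_cst. Qed.

Lemma ccyl_cont_RtoC (F : S -> R) : cyl_cont F -> ccyl_cont (fun f => RtoC (F f)).
Proof. by split => //=; exact: cyl_cont_cst. Qed.

Lemma ccyl_contD (F G : S -> R[i]) : ccyl_cont F -> ccyl_cont G ->
  ccyl_cont (fun f => F f + G f).
Proof.
move=> [Fr Fi] [Gr Gi]; split.
  by under [X in cyl_cont X]funext do rewrite Re_cD; exact: cyl_contD.
by under [X in cyl_cont X]funext do rewrite Im_cD; exact: cyl_contD.
Qed.

Lemma ccyl_contM (F G : S -> R[i]) : ccyl_cont F -> ccyl_cont G ->
  ccyl_cont (fun f => F f * G f).
Proof.
move=> [Fr Fi] [Gr Gi]; split.
  under [X in cyl_cont X]funext do rewrite Re_cM -mulN1r.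
  apply: cyl_contD; first exact: cyl_contM.
  by apply: cyl_contM; [exact: cyl_cont_cst | exact: cyl_contM].
under [X in cyl_cont X]funext do rewrite Im_cM.
by apply: cyl_contD; exact: cyl_contM.
Qed.

Lemma ccyl_cont_sum (I : eqType) (r : seq I) (F : I -> S -> R[i]) :
  {in r, forall i, ccyl_cont (F i)} -> ccyl_cont (fun f => \sum_(i <- r) F i f).
Proof.
elim: r => [_|i r IH cF].
  by under [X in ccyl_cont X]funext do rewrite big_nil; exact: ccyl_cont_cst.
under [X in ccyl_cont X]funext do rewrite big_cons.
apply: ccyl_contD; first by apply: cF; rewrite mem_head.
by apply: IH => j jr; apply: cF; rewrite inE jr orbT.
Qed.

Lemma ccyl_cont_cexp (F : S -> R[i]) : ccyl_cont F -> ccyl_cont (fun f => cexp (F f)).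
Proof.
move=> [Fr Fi]; split.
  under [X in cyl_cont X]funext do rewrite Re_cexp.
  by apply: cyl_contM; apply: cyl_cont_comp => //; [exact: continuous_expR | exact: continuous_cos].
under [X in cyl_cont X]funext do rewrite Im_cexp.
by apply: cyl_contM; apply: cyl_cont_comp => //; [exact: continuous_expR | exact: continuous_sin].
Qed.

End cylinder_functionals.

Lemma cexpectationZ {R : realType} d (Om : measurableType d) (P : probability Om R)
  (z : R[i]) (Z : Om -> R[i]) :
  P.-integrable setT (EFin \o (fun w => Re_c (Z w))) ->
  P.-integrable setT (EFin \o (fun w => Im_c (Z w))) ->
  cexpectation P (fun w => z * Z w) = z * cexpectation P Z.
Proof.
move=> iR iI; apply: complex_partsP.
  rewrite Re_cM /cexpectation/= -!RintegralZl// -RintegralB//.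
  - by apply: eq_Rintegral => w _; rewrite Re_cM.
  - exact: (integrableZl measurableT (Re_c z) iR).
  - exact: (integrableZl measurableT (Im_c z) iI).
rewrite Im_cM /cexpectation/= -!RintegralZl// -RintegralD//.
- by apply: eq_Rintegral => w _; rewrite Im_cM.
- exact: (integrableZl measurableT (Re_c z) iI).
- exact: (integrableZl measurableT (Im_c z) iR).
Qed.

Lemma integrable_le1 {R : realType} d (Om : measurableType d) (P : probability Om R)
  (Z : Om -> R) : measurable_fun setT Z -> (forall w, `|Z w| <= 1) ->
  P.-integrable setT (EFin \o Z).
Proof.
move=> mZ Z1; apply: (@le_integrable _ _ _ P setT measurableT _ (fun w => (1%R : R)%:E)).
- exact/measurable_EFinP.
- by move=> w _ /=; rewrite lee_fin normr1.
apply/integrableP; split; first exact/measurable_EFinP.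
under eq_integral do rewrite /= normr1.
by rewrite integral_cst// mul1e (le_lt_trans (probability_le1 P measurableT)) ?ltry.
Qed.

Lemma cexpectation_cst {R : realType} d (Om : measurableType d) (P : probability Om R)
  (z : R[i]) : cexpectation P (fun=> z) = z.
Proof.
have PT : fine (P setT) = 1 by rewrite probability_setT.
by case: z => x y; rewrite /cexpectation/= !Rintegral_cst// PT !mulr1.
Qed.

(** The sign is what turns Re(u1) <= 0 into a nonpositive real part of u1 p1(X). *)
Lemma pseries_sq_power_sum {R : realType} (p : nat -> R) : negligible_dfact p ->
  power_sum (pseries_sq p) (pow_series (pseries_sq p)) /\
  forall x, 0 <= pow_series (pseries_sq p) x.
Proof.
move=> /negligible_power_sum hp.
have hsq : power_sum (pseries_sq p) (fun x => pow_series p x * pow_series p x).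
  exact: (power_sumM hp hp).
have E x : pow_series (pseries_sq p) x = pow_series p x * pow_series p x.
  by apply: cvg_lim => //; exact: hsq.
by split=> x; rewrite E; [exact: hsq | rewrite -expr2 sqr_ge0].
Qed.

Lemma entire_power_sum {R : realType} (al : nat -> R) (h : R -> R) : power_sum al h -> entire h.
Proof. by exists al. Qed.

Theorem theorem7p3 (R : realType) (d : measure_display) (Om : measurableType d)
  (P : probability Om R) (W : R -> Om -> R) (a b c T : R)
  (u1 u2 u3 v : R -> R[i]) (p p2 p3 q : nat -> R) (n : nat) (t : R)
  (Y : R -> R -> Om -> R) :
  brownian_motion P W ->
  c != 0 -> 0 < T ->
  ccontinuous_on `[0, T] u1 -> ccontinuous_on `[0, T] u2 ->
  ccontinuous_on `[0, T] u3 -> ccontinuous_on `[0, T] v ->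
  (forall s, 0 <= s <= T -> Re_c (u1 s) <= 0) ->
  (forall s, 0 <= s <= T -> Re_c (u2 s) = 0) ->
  (forall s, 0 <= s <= T -> Re_c (u3 s) = 0) ->
  (forall s, 0 <= s <= T -> Re_c (v s) = 0) ->
  negligible_dfact p -> negligible_dfact p2 -> negligible_dfact p3 ->
  negligible_dfact q ->
  (1 <= n)%N -> 0 <= t <= T ->
  (forall x, ou_solution_from W a b c T t x (Y x)) ->
  let f := fun x : R => cexpectation P (fun w =>
       cexp (mu_n_integral n T t (fun s =>
                 u1 s * RtoC (pow_series (pseries_sq p) (Y x s w))
               + u2 s * RtoC (pow_series p2 (Y x s w))
               + u3 s * RtoC (pow_series p3 (Y x s w)))
             + v T * RtoC (pow_series q (Y x T w)))) in
  exists coef : nat -> R[i], forall x : R,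
    ccvg (fun N => \sum_(k < N) coef k * RtoC x ^+ k) (f x).
Proof.
move=> bm c0 T0 _ _ _ _ Ru1 Ru2 Ru3 Rv hp hp2 hp3 hq n1 /andP[t0 tT] solY f.
apply: centire_coef.
have [psP ps0] := pseries_sq_power_sum p hp.
have p2P := negligible_power_sum p2 hp2; have p3P := negligible_power_sum p3 hp3.
have qP := negligible_power_sum q hq.
have n0 : n%:R != 0 :> R by rewrite pnatr_eq0 -lt0n.
have n0' : 0 < n%:R :> R by rewrite ltr0n.
have Yt x w : Y x t w = x.
  have [_ ->] := solY x w; last by rewrite lexx.
  by rewrite set_itv1 Rintegral_set1 subrr mulr0 !addr0.
pose s i : R := i%:R * T / n%:R.
have s_le i j : (s i <= s j) = (i <= j)%N.
  by rewrite /s -!mulrA ler_pM2r ?divr_gt0// ler_nat.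
have s_lt i j : (s i < s j) = (i < j)%N by rewrite ltNge s_le -ltnNge.
have sn : s n = T by rewrite /s mulrAC mulfV// mul1r.
pose term (s' y : R) := u1 s' * RtoC (pow_series (pseries_sq p) y)
  + u2 s' * RtoC (pow_series p2 y) + u3 s' * RtoC (pow_series p3 y).
have fE x : f x = cexpectation P (fun w => cexp ((T / n%:R)%:C%C *
    \sum_(i < n | t <= s i <= T) term (s i) (Y x (s i) w)
    + v T * RtoC (pow_series q (Y x T w)))) by [].
move: tT; rewrite le_eqVlt => /predU1P[tT|tT].
  (* At t = T no atom of mu_n remains, since its last one lies before T, and X_T = x is
     deterministic. *)
  apply: (@centire_ext _ (fun x => cexp (v T * RtoC (pow_series q x)))).
    move=> x; rewrite fE -[LHS](cexpectation_cst _ _ P); congr (cexpectation P _).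
    apply/funext => w; rewrite big_pred0 ?mulr0 ?add0r.
      by rewrite -{3}tT Yt.
    by move=> i; rewrite tT -sn s_le leqNgt ltn_ord.
  apply: centire_cexp; apply: centireM; first exact: centire_cst.
  exact/centire_RtoC/(entire_power_sum _ _ qP).
(* The search for the first grid index after t runs up to n, whose point is T. When i0 = n, M is 0
   and only the terminal time is left. *)
have [i0 ti0 i0min] : exists2 i0, t < s i0 & forall i, t < s i -> (i0 <= i)%N.
  have ex : exists i, t < s i by exists n; rewrite sn.
  by exists (ex_minn ex); case: ex_minnP.
have i0n : (i0 <= n)%N by apply: i0min; rewrite sn.
have lt_ts i : (t < s i) = (i0 <= i)%N.
  by apply/idP/idP => [/i0min//|]; rewrite -s_le; exact: lt_le_trans.
pose M := (n - i0)%N; pose tau := s i0 - t; pose Dl := T / n%:R.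
have ptE m : t + tau + m%:R * Dl = s (m + i0)%N.
  by rewrite /tau /s /Dl natrD; ring.
have tau0 : 0 < tau by rewrite subr_gt0.
have Dl0 : 0 < Dl by rewrite divr_gt0.
have TE : T = t + tau + M%:R * Dl by rewrite ptE /M subnK.
pose A x := (T / n%:R)%:C%C * \sum_(i < n | s i == t) term (s i) x.
(* Coordinate m stands for the value at grid point m + i0. The sum stops before M because T is not
   an atom of mu_n; coordinate M carries the terminal term. *)
pose B (g : nat -> R) := (T / n%:R)%:C%C * \sum_(0 <= m < M) term (s (m + i0)%N) (g m)
    + v T * RtoC (pow_series q (g M)).
have split x w : (T / n%:R)%:C%C * \sum_(i < n | t <= s i <= T) term (s i) (Y x (s i) w)
    + v T * RtoC (pow_series q (Y x T w)) =
    A x + B (fun m => Y x (t + tau + m%:R * Dl) w).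
  rewrite /A /B -TE addrA -mulrDr; congr (_ * _ + _).
  rewrite (bigID (fun i : 'I_n => s i == t))/=; congr (_ + _).
    apply: eq_big => [i|i /andP[_ /eqP si]]; last by rewrite si Yt.
    by have [->|] := eqVneq (s i) t; rewrite ?andbF// lexx/= (ltW tT).
  transitivity (\sum_(i0 <= i < n) term (s i) (Y x (s i) w)).
    rewrite big_geq_mkord; apply: eq_bigl => i.
    by rewrite -lt_ts lt_neqAle eq_sym -sn s_le (ltnW (ltn_ord i)) andbT andbC.
  rewrite -{1}[i0]add0n big_addn; apply: eq_bigr => m _.
  by rewrite ptE.
have sT i : (i <= n)%N -> 0 <= s i <= T.
  move=> ni; apply/andP; split; last by rewrite -sn s_le.
  by rewrite /s divr_ge0// mulr_ge0// ltW.
have ReM (z : R[i]) (r : R) : Re_c (z * RtoC r) = Re_c z * r.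
  by rewrite Re_cM/= mulr0 subr0.
(* The bound is needed for every real sequence, not only for samples of X, because the functional is
   also evaluated along the Euler schemes. *)
have ReB g : Re_c (B g) <= 0.
  rewrite /B Re_cD ReM Rv ?lexx ?(ltW T0)// mul0r addr0 mulrC ReM Re_c_sum.
  rewrite pmulr_lle0// big_nat; apply: sumr_le0 => m /andP[_ mM].
  have sm : 0 <= s (m + i0)%N <= T.
    by apply: sT; rewrite -(subnK i0n) leq_add2r ltnW.
  by rewrite /term !Re_cD !ReM Ru2// Ru3// !mul0r !addr0 mulr_le0_ge0// Ru1.
have cB : ccyl_cont M B.
  have cP m (al : nat -> R) (h : R -> R) (z : R[i]) : (m <= M)%N -> power_sum al h ->
      ccyl_cont M (fun g => z * RtoC (h (g m))).
    move=> mM hal; apply: ccyl_contM; first exact: ccyl_cont_cst.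
    exact/ccyl_cont_RtoC/(cyl_cont_power_sum _ _ _ _ mM hal).
  apply: ccyl_contD; last exact: (cP _ _ _ _ (leqnn M) qP).
  apply: ccyl_contM; first exact: ccyl_cont_cst.
  apply: ccyl_cont_sum => m; rewrite mem_index_iota => /andP[_ /ltnW mM].
  apply: ccyl_contD; last exact: (cP _ _ _ _ mM p3P).
  apply: ccyl_contD; last exact: (cP _ _ _ _ mM p2P).
  exact: (cP _ _ _ _ mM psP).
have [[mR cR] [mI cI]] := ccyl_cont_cexp _ _ cB.
have R1 g := norm_Re_cexp_le1 _ (ReB g); have I1 g := norm_Im_cexp_le1 _ (ReB g).
pose YY x w := fun m : nat => Y x (t + tau + m%:R * Dl) w.
apply: (@centire_ext _ (fun x => cexp (A x) * cexpectation P (fun w => cexp (B (YY x w))))).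
  move=> x; rewrite fE -cexpectationZ.
  - by congr cexpectation; apply/funext => w; rewrite split (cexpD (A x)).
  - apply: (integrable_le1 _ _ P _ _ (fun w => R1 (YY x w))).
    exact: (measurable_ou P W a b c t tau Dl T M Y bm t0 tau0 Dl0 TE solY _ mR cR).
  - apply: (integrable_le1 _ _ P _ _ (fun w => I1 (YY x w))).
    exact: (measurable_ou P W a b c t tau Dl T M Y bm t0 tau0 Dl0 TE solY _ mI cI).
apply: centireM.
  apply: centire_cexp; apply: centireM; first exact: centire_cst.
  apply: centire_sum => i _.
  have cP (al : nat -> R) (h : R -> R) (z : R[i]) : power_sum al h -> centire (fun x => z * RtoC (h x)).
    move=> hal; apply: centireM; first exact: centire_cst.
    exact/centire_RtoC/(entire_power_sum _ _ hal).
  apply: centireD; last exact: cP p3P.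
  by apply: centireD; [exact: cP psP | exact: cP p2P].
split.
  exact: (entire_ou_expectation P W a b c t tau Dl T M Y bm c0 t0 tau0 Dl0 TE solY _ mR R1 cR).
exact: (entire_ou_expectation P W a b c t tau Dl T M Y bm c0 t0 tau0 Dl0 TE solY _ mI I1 cI).
Qed.
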